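(* Let $T>0$, let $\varepsilon$ be a nonzero real number with $|\varepsilon|<1$, and let $\Omega=\{(x,t): -\pi<x<\pi,\ 0<t<T\}$. Let $\varphi,\psi\in C^2[-\pi,\pi]$ with $\varphi''',\psi'''\in L_2(-\pi,\pi)$ and $\varphi'(\pm\pi)=\psi'(\pm\pi)=0$. Consider the inverse problem of finding a pair $(u,f)$ with $u\in C^{2,1}_{x,t}(\Omega)$, $f\in C[-\pi,\pi]$, such that $$u_t(x,t)-u_{xx}(x,t)+\varepsilon u_{xx}(-x,t)=f(x),\quad (x,t)\in\Omega,$$ $$u(x,0)=\varphi(x),\quad u(x,T)=\psi(x),\quad x\in[-\pi,\pi],$$ $$u_x(-\pi,t)=0,\quad u_x(\pi,t)=0,\quad t\in[0,T].$$ Then a unique solution of this problem exists, and it is given by $$u(x,t)=\varphi(x)+\frac tT(\psi_0-\varphi_0)+\sum_{k=1}^\infty\frac{\left(1-e^{-(1-\varepsilon)k^2t}\right)\left(\psi^{(3)}_{2k}-\varphi^{(3)}_{2k}\right)}{\left(1-e^{-(1-\varepsilon)k^2T}\right)k^3}\cos kx-\sum_{k=0}^\infty\frac{\left(1-e^{-(1+\varepsilon)(k+\frac12)^2t}\right)\left(\psi^{(3)}_{1k}-\varphi^{(3)}_{1k}\right)}{\left(1-e^{-(1+\varepsilon)(k+\frac12)^2T}\right)(k+\frac12)^3}\sin\left(k+\tfrac12\right)x,$$ $$f(x)=-\varphi''(x)+\varepsilon\varphi''(-x)+\frac{\psi_0-\varphi_0}{T}-\sum_{k=1}^\infty\frac{(1-\varepsilon)\left(\varphi^{(3)}_{2k}-\psi^{(3)}_{2k}\right)}{k\left(1-e^{-(1-\varepsilon)k^2T}\right)}\cos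 kx+\sum_{k=0}^\infty\frac{(1+\varepsilon)\left(\varphi^{(3)}_{1k}-\psi^{(3)}_{1k}\right)}{(k+\frac12)\left(1-e^{-(1+\varepsilon)(k+\frac12)^2T}\right)}\sin\left(k+\tfrac12\right)x,$$ where $$\varphi_0=\frac1{2\pi}\int_{-\pi}^\pi\varphi(x)\,dx,\quad \psi_0=\frac1{2\pi}\int_{-\pi}^\pi\psi(x)\,dx,$$ $$\varphi^{(3)}_{1k}=\frac1\pi\int_{-\pi}^\pi\varphi'''(x)\cos\left(k+\tfrac12\right)x\,dx,\quad \varphi^{(3)}_{2k}=\frac1\pi\int_{-\pi}^\pi\varphi'''(x)\sin kx\,dx,$$ $$\psi^{(3)}_{1k}=\frac1\pi\int_{-\pi}^\pi\psi'''(x)\cos\left(k+\tfrac12\right)x\,dx,\quad \psi^{(3)}_{2k}=\frac1\pi\int_{-\pi}^\pi\psi'''(x)\sin kx\,dx.$$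
   Context: $C^{2,1}_{x,t}(\Omega)$ denotes functions on $\Omega$ that are twice continuously differentiable in $x$ and once continuously differentiable in $t$. A pair $(u,f)$ with $u\in C^{2,1}_{x,t}(\Omega)$, $f\in C[-\pi,\pi]$ satisfying the equation and conditions is called a regular solution.
   Formalization: A regular solution is also required to have u and u_x continuous on the closed rectangle [-π,π]×[0,T]; with u only in C^{2,1}(Ω) the initial, final and boundary conditions are not tied to the interior and uniqueness fails. *)

(* Defs.v *)
From HB Require Import structures.
From mathcomp Require Import all_boot all_order all_algebra.
From mathcomp Require Import all_classical all_reals all_analysis.
Set Implicit Arguments. Unset Strict Implicit. Unset Printing Implicit Defensive.
Import Order.TTheory GRing.Theory Num.Theory.
Import numFieldNormedType.Exports.
Local Open Scope classical_set_scope.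
Local Open Scope ring_scope.

Section Defs.
Variable R : realType.

Definition Ipi : set R := `[- pi, pi].
Definition Omega (T : R) : set (R * R) :=
  [set p | - pi < p.1 < pi /\ 0 < p.2 < T].
Definition Omega_bar (T : R) : set (R * R) :=
  [set p | - pi <= p.1 <= pi /\ 0 <= p.2 <= T].

(* g has derivative l at x relative to the set D: the difference quotient
   (g (x+h) - g x)/h tends to l as h -> 0 with h <> 0 and x + h in D.
   For x interior to D this is the usual derivative; at an endpoint of a
   closed interval it is the one-sided derivative. *)
Definition deriv_within (D : set R) (g : R -> R) (x l : R) : Prop :=
  (fun h => h^-1 * (g (x + h) - g x))
    @ within (fun h : R => D (x + h) /\ h != 0) (nbhs (0 : R)) --> l.

(* phi in C^2[-pi,pi] with phi' = phi1, phi'' = phi2, and phi''' = phi3 in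
   L_2(-pi,pi) (i.e. phi2 is the indefinite integral of phi3, which is
   square-integrable). *)
Definition C2_H3_data (phi phi1 phi2 phi3 : R -> R) : Prop :=
  (forall x, Ipi x -> deriv_within Ipi phi x (phi1 x)) /\
  (forall x, Ipi x -> deriv_within Ipi phi1 x (phi2 x)) /\
  {within Ipi, continuous phi2} /\
  measurable_fun Ipi phi3 /\
  (\int[lebesgue_measure]_(x in Ipi) ((phi3 x) ^+ 2)%:E < +oo)%E /\
  (forall x, Ipi x ->
     phi2 x = phi2 (- pi) + \int[lebesgue_measure]_(y in `[- pi, x]) phi3 y).

Definition regular_solution (eps T : R) (phi psi : R -> R)
    (u : R -> R -> R) (f : R -> R) : Prop :=
  exists ux uxx ut : R -> R -> R,
    {within Omega_bar T, continuous (fun p : R * R => u p.1 p.2)} /\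
    (forall x t, Omega_bar T (x, t) -> deriv_within Ipi (fun y => u y t) x (ux x t)) /\
    {within Omega_bar T, continuous (fun p : R * R => ux p.1 p.2)} /\
    (forall x t, Omega T (x, t) ->
       deriv_within [set y | - pi < y < pi] (fun y => ux y t) x (uxx x t)) /\
    (forall x t, Omega T (x, t) ->
       deriv_within [set s | 0 < s < T] (fun s => u x s) t (ut x t)) /\
    {within Omega T, continuous (fun p : R * R => uxx p.1 p.2)} /\
    {within Omega T, continuous (fun p : R * R => ut p.1 p.2)} /\
    {within Ipi, continuous f} /\
    (forall x t, Omega T (x, t) ->
       ut x t - uxx x t + eps * uxx (- x) t = f x) /\
    (forall x, Ipi x -> u x 0 = phi x) /\
    (forall x, Ipi x -> u x T = psi x) /\
    (forall t, 0 <= t <= T -> ux (- pi) t = 0 /\ ux pi t = 0).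

Definition mean0 (g : R -> R) : R :=
  (2 * pi)^-1 * \int[lebesgue_measure]_(x in Ipi) g x.
Definition fcoef1 (g3 : R -> R) (k : nat) : R :=
  pi^-1 * \int[lebesgue_measure]_(x in Ipi) (g3 x * cos ((k%:R + 2^-1) * x)).
Definition fcoef2 (g3 : R -> R) (k : nat) : R :=
  pi^-1 * \int[lebesgue_measure]_(x in Ipi) (g3 x * sin (k%:R * x)).

Definition series_to (m : nat) (a : nat -> R) (s : R) : Prop :=
  (fun n => \sum_(m <= k < n) a k) @ \oo --> s.

End Defs.

(* Main.v *)
(* Expand in the Neumann eigenfunctions 1, cos(kx), sin((k+1/2)x) of -d^2/dx^2
   on [-pi, pi]. Each has a parity, so the reflected term only changes the decay
   rate, to (1-eps)k^2 on cosines and (1+eps)(k+1/2)^2 on sines, and each mode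
   satisfies a scalar problem a' = -lam a + F with a(0) and a(T) prescribed,
   which determines a and F.

   Completeness: with s = sin(x/2), multiplication by s maps the span of the
   system into itself, so a continuous g orthogonal to the system is orthogonal
   to all powers of Q = 1 - (s - s0)^2/8. As s is strictly increasing on
   [-pi, pi], Q^n peaks at the point x0 with s(x0) = s0, and g(x0) > 0 is
   impossible.

   Uniqueness: u_t and u_xx need not be integrable up to x = -pi, pi, so a mode
   is first truncated to [-r, r]; the resulting boundary term tends to 0
   uniformly in t as r -> pi because u_x is continuous up to the boundary.

   Existence: three integrations by parts turn the coefficients of phi and psi
   into those of their third derivatives, which are square summable by Bessel's
   inequality, so the series and their derivatives converge uniformly. The
   condition at t = T is again completeness. *)

Require Import Defs.
From HB Require Import structures.
From mathcomp Require Import all_boot all_order all_algebra.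
From mathcomp Require Import all_classical all_reals all_analysis.
From mathcomp Require Import measurable_realfun ring lra.
Import Order.TTheory GRing.Theory Num.Theory.
Import numFieldNormedType.Exports.
Local Open Scope classical_set_scope.
Local Open Scope ring_scope.

Set Implicit Arguments.
Unset Strict Implicit.
Unset Printing Implicit Defensive.

(** The function phi is not expanded: u is sought as phi + t m plus two mode series whose
    coefficients come from psi - phi. In each mode the weight (1 - e^(-lam t)) / (1 - e^(-lam T)) is
    0 at t = 0 and 1 at t = T, so the initial condition holds term by term, while the final one
    asserts that psi - phi is the sum of its expansion. As |eps| < 1 makes both rates positive and
    the frequencies are at least 1/2, the denominators stay away from 0. One derivative in t or two
    in x costs a factor of order nu_k^2, and the coefficients have the form d_k / nu_k^3 with d_k
    square summable; a single majorant of order |d_k| / nu_k therefore serves all the series. The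
    third integration by parts is the delicate one: phi'' is merely an indefinite integral of
    phi''', so it may fail to be differentiable at some points, and the fundamental theorem does not
    apply to its product with a smooth function. A comparison of increments on short intervals
    replaces it. *)

(** * Derivatives relative to a set *)

Section DerivWithin.
Variable R : realType.
Implicit Types (D : set R) (f g : R -> R).

Lemma deriv_withinP D g x l : deriv_within D g x l <->
  forall e, 0 < e -> exists2 d, 0 < d & forall h, `|h| < d -> D (x + h) ->
    h != 0 -> `|h^-1 * (g (x + h) - g x) - l| < e.
Proof.
split=> [gl e e0|gl].
  have /cvgrPdist_lt/(_ e e0)[d /= d0 dP] := gl.
  exists d => // h hd Dh h0; rewrite distrC; apply: dP => //=.
  by rewrite sub0r normrN.
apply/cvgrPdist_lt => e /gl[d d0 dP]; exists d => //= h.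
by rewrite /= sub0r normrN distrC => hd [Dh h0]; exact: dP.
Qed.

Lemma deriv_within_subset D D' g x l :
  D' `<=` D -> deriv_within D g x l -> deriv_within D' g x l.
Proof.
move=> DD' /deriv_withinP gl; apply/deriv_withinP => e /gl[d d0 dP].
by exists d => // h hd /DD'; exact: dP.
Qed.

Lemma is_derive_within D g (x l : R) :
  is_derive x 1 g l -> deriv_within D g x l.
Proof.
move=> [/[swap] <- dg]; apply/deriv_withinP => e e0.
have /cvgrPdist_lt/(_ e e0)[d /= d0 dP] := dg.
exists d => // h hd Dh h0; rewrite distrC.
have := dP h; rewrite /= sub0r normrN => /(_ hd h0).
by rewrite /shift /= (_ : h *: 1 + x = x + h) // addrC [_ *: _]mulr1.
Qed.

Lemma deriv_within_is_derive D g (x l : R) :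
  nbhs x D -> deriv_within D g x l -> is_derive x 1 g l.
Proof.
move=> [r /= r0 rD] /deriv_withinP gl.
have cv : (fun h => h^-1 *: ((g \o shift x) (h *: 1) - g x)) @ 0^' --> l.
  apply/cvgrPdist_lt => e /gl[d d0 dP]; exists (Num.min d r) => /=.
    by rewrite lt_min d0.
  move=> h; rewrite /= sub0r normrN lt_min => /andP[hd hr] h0.
  rewrite distrC (_ : h *: 1 + x = x + h); last first.
    by rewrite addrC [_ *: 1]mulr1.
  have Dh : D (x + h).
    by apply: rD; rewrite /ball/= opprD addrA subrr sub0r normrN.
  exact: (dP h hd Dh h0).
by split; [apply/cvg_ex; exists l|exact: cvg_lim cv].
Qed.

Lemma deriv_withinD D f g x l m :
  deriv_within D f x l -> deriv_within D g x m ->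
  deriv_within D (fun y => f y + g y) x (l + m).
Proof.
move=> fl gm; rewrite /deriv_within.
suff -> : (fun h => h^-1 * (f (x + h) + g (x + h) - (f x + g x))) =
  (fun h => h^-1 * (f (x + h) - f x)) \+ (fun h => h^-1 * (g (x + h) - g x)).
  exact: cvgD fl gm.
by apply/funext => h /=; rewrite -mulrDr opprD addrACA.
Qed.

Lemma deriv_withinZ D f x l k :
  deriv_within D f x l -> deriv_within D (fun y => k * f y) x (k * l).
Proof.
move=> fl; rewrite /deriv_within.
suff -> : (fun h => h^-1 * (k * f (x + h) - k * f x)) =
  (fun=> k) \* (fun h => h^-1 * (f (x + h) - f x)).
  exact: cvgM (cvg_cst k) fl.
by apply/funext => h /=; rewrite -mulrBr mulrCA.
Qed.

Lemma deriv_withinB D f g x l m :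
  deriv_within D f x l -> deriv_within D g x m ->
  deriv_within D (fun y => f y - g y) x (l - m).
Proof.
move=> fl /(@deriv_withinZ D g x m (-1)); rewrite mulN1r => /(deriv_withinD fl).
suff -> : (fun y => f y - g y) = (fun y => f y + -1 * g y) by [].
by apply/funext => y; rewrite mulN1r.
Qed.

Lemma deriv_within_cvg D g x l :
  deriv_within D g x l -> g @ within D (nbhs x) --> g x.
Proof.
move=> /deriv_withinP gl; apply/cvgrPdist_lt => e e0.
have [d d0 dP] := gl _ ltr01.
(* Within [d] of x the difference quotient is at distance less than 1 from [l], hence at most |l| +
   1 in absolute value. *)
exists (Num.min d (e / (`|l| + 1))) => /=.
  by rewrite lt_min d0 divr_gt0// ltr_wpDl.
move=> y /=; rewrite lt_min => /andP[yd ye] Dy.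
have [->|yx] := eqVneq y x; first by rewrite subrr normr0.
have yx0 : y - x != 0 by rewrite subr_eq0.
have := dP (y - x); rewrite distrC => /(_ yd); rewrite addrC subrK.
move=> /(_ Dy yx0) h; rewrite distrC.
rewrite (_ : g y - g x = (y - x) * ((y - x)^-1 * (g y - g x))); last first.
  by rewrite mulrA divff// mul1r.
rewrite normrM; move: ye; rewrite ltr_pdivlMr ?ltr_wpDl// distrC.
apply: le_lt_trans; rewrite ler_wpM2l// -lerBlDl.
by apply: le_trans (ltW h); exact: lerB_dist.
Qed.

Lemma deriv_within_continuous D g g' :
  (forall x, D x -> deriv_within D g x (g' x)) -> {within D, continuous g}.
Proof.
move=> dg; apply/subspace_continuousP => x Dx.
exact: deriv_within_cvg (dg x Dx).
Qed.

End DerivWithin.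

(** * Integrals and continuity on a segment *)

Section SegmentIntegral.
Variable R : realType.
Notation mu := (@lebesgue_measure R).
Implicit Types (f g F G : R -> R).

Lemma within_continuousD (T : topologicalType) (A : set T) (f g : T -> R) :
  {within A, continuous f} -> {within A, continuous g} ->
  {within A, continuous (fun x => f x + g x)}.
Proof. by move=> cf cg x; apply: cvgD; [exact: cf|exact: cg]. Qed.

Lemma within_continuousB (T : topologicalType) (A : set T) (f g : T -> R) :
  {within A, continuous f} -> {within A, continuous g} ->
  {within A, continuous (fun x => f x - g x)}.
Proof. by move=> cf cg x; apply: cvgB; [exact: cf|exact: cg]. Qed.

Lemma within_continuousM (T : topologicalType) (A : set T) (f g : T -> R) :
  {within A, continuous f} -> {within A, continuous g} ->
  {within A, continuous (fun x => f x * g x)}.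
Proof. by move=> cf cg x; apply: cvgM; [exact: cf|exact: cg]. Qed.

Lemma within_continuous_cst (T : topologicalType) (A : set T) (k : R) :
  {within A, continuous (fun=> k)}.
Proof. by move=> x; exact: cvg_cst. Qed.

Lemma is_derive_continuous f f' : (forall x : R, is_derive x 1 f (f' x)) ->
  continuous f.
Proof.
by move=> df x; apply/differentiable_continuous/derivable1_diffP; case: (df x).
Qed.

Lemma is_derive_within_continuous (A : set R) f f' :
  (forall x : R, is_derive x 1 f (f' x)) -> {within A, continuous f}.
Proof. by move=> /is_derive_continuous cf; exact: continuous_subspaceT. Qed.

Lemma within_continuous_integrable a b f :
  {within `[a, b], continuous f} -> mu.-integrable `[a, b] (EFin \o f).
Proof. by apply: continuous_compact_integrable; exact: segment_compact. Qed.

Lemma Rintegral_continuousD a b f g :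
  {within `[a, b], continuous f} -> {within `[a, b], continuous g} ->
  \int[mu]_(x in `[a, b]) (f x + g x) =
  \int[mu]_(x in `[a, b]) f x + \int[mu]_(x in `[a, b]) g x.
Proof.
by move=> cf cg; apply: RintegralD => //; exact: within_continuous_integrable.
Qed.

Lemma Rintegral_continuousB a b f g :
  {within `[a, b], continuous f} -> {within `[a, b], continuous g} ->
  \int[mu]_(x in `[a, b]) (f x - g x) =
  \int[mu]_(x in `[a, b]) f x - \int[mu]_(x in `[a, b]) g x.
Proof.
by move=> cf cg; apply: RintegralB => //; exact: within_continuous_integrable.
Qed.

Lemma Rintegral_continuousZ a b k f :
  {within `[a, b], continuous f} ->
  \int[mu]_(x in `[a, b]) (k * f x) = k * \int[mu]_(x in `[a, b]) f x.
Proof.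
by move=> cf; apply: RintegralZl => //; exact: within_continuous_integrable.
Qed.

Lemma Rintegral_segment_cst a b k : a <= b ->
  \int[mu]_(x in `[a, b]) k = k * (b - a).
Proof.
move=> ab; rewrite Rintegral_cst//= lebesgue_measure_itv/= lte_fin.
move: ab; rewrite le_eqVlt => /predU1P[->|->//].
by rewrite ltxx subrr.
Qed.

Lemma normr_Rintegral_le a b f M : a <= b ->
  mu.-integrable `[a, b] (EFin \o f) ->
  (forall x, x \in `[a, b] -> `|f x| <= M) ->
  `|\int[mu]_(x in `[a, b]) f x| <= M * (b - a).
Proof.
move=> ab fi fM; apply: (le_trans (le_normr_Rintegral _ fi)) => //.
rewrite -Rintegral_segment_cst//; apply: le_Rintegral => //.
  exact: integrable_norm fi.
by apply: within_continuous_integrable; exact: within_continuous_cst.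
Qed.

Lemma Rintegral_segmentD a b c f : a <= b -> b <= c ->
  mu.-integrable `[a, c] (EFin \o f) ->
  \int[mu]_(x in `[a, c]) f x =
  \int[mu]_(x in `[a, b]) f x + \int[mu]_(x in `[b, c]) f x.
Proof.
move=> ab bc fi.
have := @Rintegral_itvB _ f (BLeft a) (BRight c) b fi.
rewrite !bnd_simp => /(_ ab bc) /eqP; rewrite subr_eq => /eqP ->.
rewrite addrC; congr (_ + _); apply: Rintegral_itv_obnd_cbnd.
apply: integrableS fi => //; by apply: subset_itv; rewrite bnd_simp.
Qed.

(** The degenerate case a = b is included because truncation radii and lengths of subintervals may
    be 0. *)
Lemma Rintegral_FTC2 a b f F : a <= b ->
  {within `[a, b], continuous f} -> {within `[a, b], continuous F} ->
  (forall x, x \in `]a, b[ -> is_derive x 1 F (f x)) ->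
  \int[mu]_(x in `[a, b]) f x = F b - F a.
Proof.
rewrite le_eqVlt => /predU1P[<- _ _ _|ab cf cF dF].
  by rewrite set_itv1 Rintegral_set1 subrr.
rewrite /Rintegral (@continuous_FTC2 _ f F)//.
  have [_ Fa Fb] := (continuous_within_itvP F ab).1 cF.
  by split => // x /dF[].
by move=> x /dF dFx; rewrite derive1E; exact: derive_val.
Qed.

Lemma Rintegral_opp r f : 0 <= r -> {within `[- r, r], continuous f} ->
  \int[mu]_(x in `[- r, r]) f (- x) = \int[mu]_(x in `[- r, r]) f x.
Proof.
move=> r0 cf; rewrite /Rintegral; congr fine.
have := @integration_by_substitution_oppr _ f (- r) r.
by rewrite opprK => -> //; rewrite lerNl ?opprK; rewrite ge0_cp.
Qed.

Lemma within_continuous_opp r f :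
  {within `[- r, r], continuous f} ->
  {within `[- r, r], continuous (fun x => f (- x))}.
Proof.
move=> /subspace_continuousP cf; apply/subspace_continuousP => x xr.
have Nxr : - x \in `[- r, r].
  by move: xr; rewrite /= !in_itv/= lerN2 lerNl => /andP[-> ->].
have /cvgrPdist_lt cfx := cf _ Nxr.
apply/cvgrPdist_lt => e /cfx[d /= d0 dP]; exists d => //= y xy yr.
apply: dP => /=; first by rewrite -opprD normrN.
by move: yr; rewrite /= !in_itv/= lerN2 lerNl => /andP[-> ->].
Qed.

Lemma eq_segment_integral a b f g : (forall x, x \in `[a, b] -> f x = g x) ->
  \int[mu]_(x in `[a, b]) f x = \int[mu]_(x in `[a, b]) g x.
Proof. by move=> fg; apply: eq_Rintegral => x; rewrite inE => /fg. Qed.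

Lemma ge_Rintegral a b f m : a <= b ->
  mu.-integrable `[a, b] (EFin \o f) ->
  (forall x, x \in `[a, b] -> m <= f x) ->
  m * (b - a) <= \int[mu]_(x in `[a, b]) f x.
Proof.
move=> ab fi fm; rewrite -Rintegral_segment_cst//; apply: le_Rintegral => //.
by apply: within_continuous_integrable; exact: within_continuous_cst.
Qed.

Lemma within_continuous_bounded a b f : {within `[a, b], continuous f} ->
  exists2 M, 0 <= M & forall x, x \in `[a, b] -> `|f x| <= M.
Proof.
move=> cf; have [ab|ba] := leP a b; last first.
  exists 0 => // x; rewrite in_itv/= => /andP[ax /(le_trans ax)].
  by rewrite leNgt ba.
have cN : {within `[a, b], continuous (fun x => `|f x|)}.
  by move=> x; apply: cvg_norm; exact: cf.
by have [c _ fc] := EVT_max ab cN; exists `|f c|.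
Qed.

Lemma eq0_on_segment a b f : a < b -> {within `[a, b], continuous f} ->
  (forall x, x \in `]a, b[ -> f x = 0) -> forall x, x \in `[a, b] -> f x = 0.
Proof.
move=> ab cf f0 x xI; apply/eqP; rewrite -normr_eq0 eq_le normr_ge0 andbT.
apply/ler_addgt0Pr => e e0; rewrite add0r.
have /subspace_continuousP/(_ x xI)/cvgrPdist_lt/(_ e e0)[d /= d0 fd] := cf.
(* [y] is x moved towards the midpoint: 0 < t < 1 puts it strictly inside, and the displacement is
   at most t (b - a) < d. *)
pose t := d / (2 * (d + (b - a))); pose y := x + t * ((a + b) / 2 - x).
have D0 : 0 < 2 * (d + (b - a)) by lra.
have t0 : 0 < t by rewrite divr_gt0.
have tD : t * (2 * (d + (b - a))) = d by rewrite /t divfK// gt_eqF.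
have t1 : t < 1 by nra.
move: xI; rewrite in_itv/= => /andP[ax xb].
have yI : y \in `]a, b[ by rewrite in_itv/= /y; apply/andP; split; nra.
have yI' : y \in `[a, b] by exact: subset_itv_oo_cc.
have := fd y; rewrite /from_subspace (f0 y yI) subr0 => /(_ _ yI') h; apply/ltW/h.
have mx : `|(a + b) / 2 - x| <= b - a by rewrite ler_norml; lra.
rewrite /ball_/= distrC /y addrAC subrr add0r normrM gtr0_norm//.
by move: mx (normr_ge0 ((a + b) / 2 - x)); nra.
Qed.

End SegmentIntegral.

(** * Dominated series: limits, continuity and termwise derivatives *)

Section Series.
Variable R : realType.
Implicit Types a b M : nat -> R.

(** A total function, so that sums can be written and rewritten freely; convergence is carried by
    separate hypotheses, mostly through a majorant. *)
Definition ssum a : R := limn (series a).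

Lemma dominated_cvg_series a M : (forall k, `|a k| <= M k) ->
  cvgn (series M) -> cvgn (series a).
Proof.
move=> aM cM; apply: normed_cvg; apply: series_le_cvg cM => //= k.
exact: le_trans (aM k).
Qed.

Lemma ssumD a b : cvgn (series a) -> cvgn (series b) ->
  ssum (fun k => a k + b k) = ssum a + ssum b.
Proof. exact: lim_seriesD. Qed.

Lemma ssumZ a x : cvgn (series a) -> ssum (fun k => x * a k) = x * ssum a.
Proof. by move=> ca; apply: (lim_seriesZ x ca). Qed.

Lemma cvg_seriesZ a x : cvgn (series a) -> cvgn (series (fun k => x * a k)).
Proof. by move=> ca; apply: (@is_cvg_seriesZ _ _ x ca). Qed.

Lemma ssum0 : ssum (fun=> 0) = 0.
Proof.
rewrite /ssum (_ : series _ = fun=> 0) ?lim_cst//.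
by apply/funext => n; rewrite /series/= big1.
Qed.

(** The Weierstrass estimate: the right-hand side does not depend on [a], which is what lets limits
    and integrals pass through [ssum]. *)
Lemma dominated_ssum_tail a M n : (forall k, `|a k| <= M k) ->
  cvgn (series M) -> `|ssum a - series a n| <= ssum M - series M n.
Proof.
move=> aM cM; have ca := dominated_cvg_series aM cM.
have c1 : (fun m => `|series a m - series a n|) @ \oo --> `|ssum a - series a n|.
  by apply: cvg_norm; apply: cvgB => //; exact: cvg_cst.
have M0 k : 0 <= M k by exact: le_trans (aM k).
rewrite -(cvg_lim _ c1)//; apply: limr_le; first by apply/cvg_ex; eexists; exact: c1.
near=> m.
have nm : (n <= m)%N by near: m; exact: nbhs_infty_ge.
apply: (@le_trans _ _ (series M m - series M n)).
  rewrite !sub_series_geq//; apply: (le_trans (ler_norm_sum _ _ _)).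
  exact: ler_sum.
rewrite lerB//; apply: nondecreasing_cvgn_le => //.
by apply: nondecreasing_series => *; exact: M0.
Unshelve. all: by end_near. Qed.

(** Tannery's theorem: a finite sum converges termwise, and the tails of [q p] and [l] are bounded
    by that of [M]. It is stated for any filter so that it covers both continuity within a set and
    limits of difference quotients. *)
Lemma dominated_cvg_ssum (X : Type) (F : set_system X) (q : X -> nat -> R)
    (l M : nat -> R) : Filter F -> cvgn (series M) ->
  (\forall p \near F, forall k, `|q p k| <= M k) ->
  (forall k, `|l k| <= M k) -> (forall k, q ^~ k @ F --> l k) ->
  (fun p => ssum (q p)) @ F --> ssum l.
Proof.
move=> FF cM qM lM ql; apply/cvgrPdist_lt => e e0.
have e30 : 0 < e / 3 by rewrite divr_gt0.
have [n Mn] : exists n, ssum M - series M n < e / 3.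
  have /cvgrPdist_lt/(_ _ e30)[N _ /(_ N (leqnn N))] := cM.
  by move=> H; exists N; exact: le_lt_trans (ler_norm _) H.
have cs : (fun p => series (q p) n) @ F --> series l n.
  rewrite /series /=; elim: n {Mn} => [|n IH].
    rewrite big_nil; under eq_fun do rewrite big_nil; exact: cvg_cst.
  rewrite big_nat_recr//=; under eq_fun do rewrite big_nat_recr//=.
  exact: cvgD.
near=> p.
have h1 : `|series l n - series (q p) n| < e / 3.
  by near: p; move/cvgrPdist_lt : cs => /(_ _ e30).
have qpM : forall k, `|q p k| <= M k by near: p.
have h2 := le_lt_trans (dominated_ssum_tail n lM cM) Mn.
have h3 := le_lt_trans (dominated_ssum_tail n qpM cM) Mn.
rewrite (_ : ssum l - ssum (q p) = (ssum l - series l n) +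
  (series l n - series (q p) n) - (ssum (q p) - series (q p) n)); last first.
  by rewrite opprB addrA addrA subrK subrK.
rewrite (_ : e = e / 3 + e / 3 + e / 3); last first.
  by rewrite -!mulrDl -mulr2n -mulrSr -[e *+ 3]mulr_natr mulfK.
apply: (le_lt_trans (ler_normB _ _)); rewrite ltrD//.
by apply: (le_lt_trans (ler_normD _ _)); rewrite ltrD.
Unshelve. all: by end_near. Qed.

Lemma ssum_within_continuous (T : topologicalType) (A : set T)
    (q : T -> nat -> R) M : cvgn (series M) ->
  (forall p, A p -> forall k, `|q p k| <= M k) ->
  (forall k, {within A, continuous (q ^~ k)}) ->
  {within A, continuous (fun p => ssum (q p))}.
Proof.
move=> cM qM cq; apply/subspace_continuousP => p Ap.
apply: (@dominated_cvg_ssum T (within A (nbhs p)) q (q p) M) => //.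
- by rewrite near_withinE; near=> x => /qM.
- exact: (qM p Ap).
- by move=> k; have /subspace_continuousP := cq k; apply.
Unshelve. all: by end_near. Qed.

Lemma derivative_bound_lipschitz (f f' : R -> R) (x y K : R) :
  (forall z : R, is_derive z 1 f (f' z)) ->
  (forall z, z \in `[Num.min x y, Num.max x y] -> `|f' z| <= K) ->
  `|f y - f x| <= K * `|y - x|.
Proof.
wlog xy : x y / x <= y => [H|df fK].
  move=> df fK; have [/H|/ltW yx] := leP x y; first exact.
  rewrite distrC (distrC y); apply: H => // z.
  by rewrite minC maxC; exact: fK.
have [z zxy ->] := @MVT_segment R f f' x y xy (fun z _ => df z)
  (is_derive_within_continuous df).
rewrite normrM ler_wpM2r//; apply: fK.
by rewrite min_l// max_r.
Qed.

(** By the mean value inequality the bound [M] on the derivatives also dominates the difference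
    quotients, so Tannery's theorem applies to them. That [A] is an interval keeps the intermediate
    points in [A], where the bound is available. *)
Lemma ssum_deriv_within (A : set R) (f f' : nat -> R -> R) (M N : nat -> R) x :
  is_interval A -> A x -> cvgn (series M) -> cvgn (series N) ->
  (forall k (z : R), is_derive z 1 (f k) (f' k z)) ->
  (forall k z, A z -> `|f k z| <= N k) ->
  (forall k z, A z -> `|f' k z| <= M k) ->
  deriv_within A (fun z => ssum (f ^~ z)) x (ssum (f' ^~ x)).
Proof.
move=> iA Ax cM cN df fN f'M; rewrite /deriv_within.
have cf z : A z -> cvgn (series (f ^~ z)).
  by move=> Az; apply: dominated_cvg_series cN => k; exact: fN.
have fM k z : A z -> `|f k z - f k x| <= M k * `|z - x|.
  move=> Az; apply: (derivative_bound_lipschitz (df k)) => y.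
  rewrite in_itv/= => yxz; apply: f'M; apply: iA yxz.
    by rewrite /Num.min; case: ifP.
  by rewrite /Num.max; case: ifP.
have cv : (fun h => ssum (fun k => h^-1 * (f k (x + h) - f k x)))
    @ within (fun h => A (x + h) /\ h != 0) (nbhs 0) --> ssum (f' ^~ x).
  apply: (@dominated_cvg_ssum R
    (within (fun h => A (x + h) /\ h != 0) (nbhs 0))
    (fun h k => h^-1 * (f k (x + h) - f k x)) (f' ^~ x) M) => //.
  - rewrite near_withinE; near=> h => -[Axh h0] k.
    rewrite normrM normfV ler_pdivrMl ?normr_gt0// mulrC.
    by have := fM k _ Axh; rewrite [x + h]addrC addrK.
  - by move=> k; exact: f'M.
  - by move=> k; exact: is_derive_within.
apply: cvg_trans cv; apply: near_eq_cvg; rewrite near_withinE.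
near=> h => -[Axh h0].
rewrite ssumZ; last by apply: is_cvg_seriesB; exact: cf.
by congr (_ * _); apply: lim_seriesB; exact: cf.
Unshelve. all: by end_near. Qed.

End Series.

(** * Completeness of the eigenfunctions for continuous functions *)

Section Completeness.
Variable R : realType.
Notation mu := (@lebesgue_measure R).

(** The product formula yields the frequencies k + 1/2 and k - 1/2; for k = 0 the latter is -1/2,
    and oddness of the sine folds it back to 1/2, inside the system. *)
Lemma cos_sin_half (k : nat) (x : R) : sin (2^-1 * x) * cos (k%:R * x) =
  2^-1 * sin ((k%:R + 2^-1) * x) +
  (if k is j.+1 then - 2^-1 * sin ((j%:R + 2^-1) * x)
   else 2^-1 * sin ((0%:R + 2^-1) * x)).
Proof.
case: k => [|k].
  have -> : (0%:R + 2^-1) * x = 2^-1 * x by lra.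
  by rewrite mul0r cos0 mulr1; lra.
have -> : (k%:R + 2^-1) * x = k.+1%:R * x - 2^-1 * x by rewrite -[k.+1%:R]natr1; lra.
by rewrite mulrDl sinB sinD; lra.
Qed.

Lemma sin_sin_half (k : nat) (x : R) :
  sin (2^-1 * x) * sin ((k%:R + 2^-1) * x) =
  2^-1 * cos (k%:R * x) + - 2^-1 * cos (k.+1%:R * x).
Proof.
have -> : k%:R * x = (k%:R + 2^-1) * x - 2^-1 * x by lra.
have -> : k.+1%:R * x = (k%:R + 2^-1) * x + 2^-1 * x by rewrite -natr1; lra.
by rewrite cosB cosD; lra.
Qed.

Lemma continuous_mulr_comp (f : R -> R) (k : R) :
  continuous f -> continuous (fun x => f (k * x)).
Proof.
by move=> cf x; apply: continuous_comp; [exact: mulrl_continuous|exact: cf].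
Qed.

Lemma continuous_sin_mul (k : R) : continuous (fun x : R => sin (k * x)).
Proof. by apply: continuous_mulr_comp; exact: continuous_sin. Qed.

Lemma continuous_cos_mul (k : R) : continuous (fun x : R => cos (k * x)).
Proof. by apply: continuous_mulr_comp; exact: continuous_cos. Qed.

Variable g : R -> R.
Hypothesis cg : {within `[- pi, pi], continuous g}.

Let L (f : R -> R) := \int[mu]_(x in `[- pi, pi]) (g x * f x).

Let L_cont (f : R -> R) : continuous f -> {within `[- pi, pi], continuous (fun x => g x * f x)}.
Proof. by move=> cf; apply: within_continuousM => //; exact: continuous_subspaceT. Qed.

Let LD (f h : R -> R) (a b : R) : continuous f -> continuous h ->
  L (fun x => a * f x + b * h x) = a * L f + b * L h.
Proof.
move=> cf ch; rewrite /L -!Rintegral_continuousZ; [|exact: L_cont..].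
rewrite -Rintegral_continuousD.
- by apply: eq_segment_integral => x _; rewrite mulrDr !(mulrCA (g x)).
- by apply: within_continuousM; [exact: within_continuous_cst|exact: L_cont].
- by apply: within_continuousM; [exact: within_continuous_cst|exact: L_cont].
Qed.

(** The condition bears on the multiplier [h] of [g]: closure under sin(x/2) then only requires
    moving that factor onto the test function, with no description of the span of the system. *)
Let orth (h : R -> R) := [/\ continuous h,
  forall k : nat, L (fun x => h x * cos (k%:R * x)) = 0 &
  forall k : nat, L (fun x => h x * sin ((k%:R + 2^-1) * x)) = 0].

Let cvgMfun (f h : R -> R) : continuous f -> continuous h ->
  continuous (fun x => f x * h x).
Proof. by move=> cf ch x; apply: cvgM; [exact: cf|exact: ch]. Qed.

Let orthD f h a b : orth f -> orth h -> orth (fun x => a * f x + b * h x).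
Proof.
move=> [cf f1 f2] [ch h1 h2]; split.
- move=> x; apply: cvgD; apply: cvgM; by [exact: cvg_cst|exact: cf|exact: ch].
- move=> k; transitivity (a * L (fun x => f x * cos (k%:R * x)) +
      b * L (fun x => h x * cos (k%:R * x))); last by rewrite f1 h1 !mulr0 addr0.
  rewrite -LD; [|by apply: cvgMfun => //; exact: continuous_cos_mul..].
  by apply: eq_segment_integral => x _; rewrite mulrDl !mulrA.
- move=> k; transitivity (a * L (fun x => f x * sin ((k%:R + 2^-1) * x)) +
      b * L (fun x => h x * sin ((k%:R + 2^-1) * x))); last by rewrite f2 h2 !mulr0 addr0.
  rewrite -LD; [|by apply: cvgMfun => //; exact: continuous_sin_mul..].
  by apply: eq_segment_integral => x _; rewrite mulrDl !mulrA.
Qed.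

Let orth_sin f : orth f -> orth (fun x => sin (2^-1 * x) * f x).
Proof.
move=> [cf f1 f2].
have ccos k : continuous (fun x => f x * cos (k * x)).
  by apply: cvgMfun => //; exact: continuous_cos_mul.
have csin k : continuous (fun x => f x * sin (k * x)).
  by apply: cvgMfun => //; exact: continuous_sin_mul.
split.
- by apply: cvgMfun => //; exact: continuous_sin_mul.
(* At k = 0 the predecessor [k.-1] is 0, in agreement with the folded frequency of
   [cos_sin_half]. *)
- move=> k; transitivity (2^-1 * L (fun x => f x * sin ((k%:R + 2^-1) * x)) +
    (if k is j.+1 then - 2^-1 else 2^-1) *
       L (fun x => f x * sin ((k.-1%:R + 2^-1) * x))); last first.
    by rewrite !f2 !mulr0 addr0.
  rewrite -LD //; apply: eq_segment_integral => x _.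
  rewrite -(mulrAC _ (cos _)) cos_sin_half mulrDl; congr (g x * (_ + _)).
    by rewrite mulrAC mulrA.
  by case: k => [|k]; rewrite -mulrA (mulrC (f x)).
- move=> k; transitivity (2^-1 * L (fun x => f x * cos (k%:R * x)) +
    (- 2^-1) * L (fun x => f x * cos (k.+1%:R * x))); last first.
    by rewrite !f1 !mulr0 addr0.
  rewrite -LD //; apply: eq_segment_integral => x _.
  rewrite -(mulrAC _ (sin ((_ + _) * _))) sin_sin_half mulrDl.
  by rewrite -!mulrA !(mulrC (f x)).
Qed.

(** For s0 in [-1, 1] the difference is at most 2 in absolute value, so the factor 1/8 keeps [Q]
    between 1/2 and 1, with value 1 only where sin(x/2) = s0. *)
Let Q (s0 x : R) := 1 - 8^-1 * (sin (2^-1 * x) - s0) ^+ 2.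

Let orth_peak s0 f : orth f -> orth (fun x => Q s0 x * f x).
Proof.
move=> of0; have of1 := orth_sin of0; have of2 := orth_sin of1.
(* The coefficients of [Q] as a quadratic polynomial in sin(x/2). *)
have := orthD 1 1 (orthD (1 - 8^-1 * s0 ^+ 2) (4^-1 * s0) of0 of1)
  (orthD (- 8^-1) 0 of2 of2).
congr orth; apply/funext => x; rewrite /Q; lra.
Qed.

Let orth_peakX s0 n : orth (fun=> 1) -> orth (fun x => Q s0 x ^+ n).
Proof.
move=> o1; elim: n => [|n IH]; first by under eq_fun do rewrite expr0.
by under eq_fun do rewrite exprS; exact: orth_peak.
Qed.

Let peak_ge0 s0 x : -1 <= s0 <= 1 -> 0 <= Q s0 x.
Proof.
move=> s01; rewrite /Q; have := sin_geN1 (2^-1 * x); have := sin_le1 (2^-1 * x).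
by move: s01; set s := sin _; nra.
Qed.

Let sin_half_lt x y : x \in `[- pi, pi] -> y \in `[- pi, pi] -> x < y ->
  sin (2^-1 * x) < sin (2^-1 * y) :> R.
Proof.
rewrite !in_itv/= => /andP[x1 x2] /andP[y1 y2] xy.
by rewrite ltr_sin ?in_itv/=; lra.
Qed.

Let sin_half_le x y : x \in `[- pi, pi] -> y \in `[- pi, pi] -> x <= y ->
  sin (2^-1 * x) <= sin (2^-1 * y) :> R.
Proof.
move=> xI yI; rewrite le_eqVlt => /predU1P[->//|xy].
by apply/ltW; exact: sin_half_lt.
Qed.

(** Near x0 the integrand is at least g(x0)/2 times q2^n on an interval of fixed length, and
    elsewhere it is at least -M q1^n with q1 < q2. Vanishing integrals would bound (q2/q1)^n
    independently of n. *)
Let peak_contra x0 : x0 \in `]- pi, pi[ -> 0 < g x0 ->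
  ~ (forall n, L (fun x => Q (sin (2^-1 * x0)) x ^+ n) = 0).
Proof.
move=> x0I gx0 LQ; set s0 := sin (2^-1 * x0) in LQ.
have pi0 := @pi_gt0 R.
have /andP[x0l x0r] : - pi < x0 < pi by move: x0I; rewrite in_itv.
have s01 : -1 <= s0 <= 1 by rewrite sin_geN1 sin_le1.
have [M M0 gM] := within_continuous_bounded cg.
have [d d0 gd] : exists2 d, 0 < d & forall x, x \in `[x0 - d, x0 + d] ->
    x \in `[- pi, pi] /\ g x0 / 2 <= g x.
  have /subspace_continuousP/(_ x0) := cg.
  have x0I' : x0 \in `[- pi, pi] by exact: subset_itv_oo_cc.
  move=> /(_ x0I')/cvgrPdist_lt/(_ (g x0 / 2)); rewrite divr_gt0// => /(_ isT).
  move=> [d /= d0 gd]; exists (Num.min (d / 2) (Num.min (x0 + pi) (pi - x0))).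
    by rewrite !lt_min divr_gt0//=; apply/andP; split; lra.
  move=> x; rewrite in_itv/= => xI.
  have [h1 h2 h3] : [/\ `|x - x0| <= d / 2, `|x - x0| <= x0 + pi &
      `|x - x0| <= pi - x0].
    have : `|x - x0| <= Num.min (d / 2) (Num.min (x0 + pi) (pi - x0)).
      by rewrite ler_distl.
    by rewrite !le_min => /and3P[].
  have xI' : x \in `[- pi, pi].
    by rewrite in_itv/=; move: h2 h3; rewrite !ler_distl; lra.
  split => //; have := gd x; rewrite /= distrC => /(_ _ xI').
  have h4 : `|x - x0| < d by lra.
  by move=> /(_ h4); rewrite ltr_distl /from_subspace/=; lra.
have [lI _] : x0 - d \in `[- pi, pi] /\ g x0 / 2 <= g (x0 - d).
  by apply: gd; rewrite in_itv/=; lra.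
have [rI _] : x0 + d \in `[- pi, pi] /\ g x0 / 2 <= g (x0 + d).
  by apply: gd; rewrite in_itv/=; lra.
have x0I' : x0 \in `[- pi, pi] by exact: subset_itv_oo_cc.
have sl : sin (2^-1 * (x0 - d)) < s0 by apply: sin_half_lt => //; lra.
have sr : s0 < sin (2^-1 * (x0 + d)) by apply: sin_half_lt => //; lra.
(* Since sin(x/2) increases, its distance to [s0] outside the window [x0 - d, x0 + d] is at least
   [eta]. *)
pose eta := Num.min (s0 - sin (2^-1 * (x0 - d))) (sin (2^-1 * (x0 + d)) - s0).
have eta0 : 0 < eta by rewrite lt_min !subr_gt0 sl sr.
have eta2 : eta <= 2.
  rewrite ge_min; apply/orP; left.
  by have := sin_geN1 (2^-1 * (x0 - d)); move: s01; lra.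
(* [q1] bounds [Q] from above outside the window; [q2] bounds it from below where the distance to
   [s0] is at most eta/2. *)
pose q1 := 1 - 8^-1 * eta ^+ 2; pose q2 := 1 - 8^-1 * (eta / 2) ^+ 2.
have q10 : 0 < q1 by rewrite /q1; nra.
have q12 : q1 < q2 by rewrite /q1 /q2; nra.
have far x : x \in `[- pi, pi] -> x \notin `[x0 - d, x0 + d] -> Q s0 x <= q1.
  move=> xI; rewrite in_itv/= negb_and -!ltNge => /orP[xl|xr].
    have := sin_half_le xI lI (ltW xl).
    have : eta <= s0 - sin (2^-1 * (x0 - d)) by rewrite ge_min lexx.
    by rewrite /Q /q1; nra.
  have := sin_half_le rI xI (ltW xr).
  have : eta <= sin (2^-1 * (x0 + d)) - s0 by rewrite ge_min lexx orbT.
  by rewrite /Q /q1; nra.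
have [d' /andP[d'0 d'd] near_x0] : exists2 d', 0 < d' <= d &
    forall x, x \in `[x0 - d', x0 + d'] -> q2 <= Q s0 x.
  have /cvgrPdist_lt/(_ (eta / 2)) := @continuous_sin_mul 2^-1 x0.
  rewrite divr_gt0// => /(_ isT)[r /= r0 rP]; exists (Num.min d (r / 2)).
    by rewrite lt_min d0 divr_gt0//= ge_min lexx.
  move=> x; rewrite in_itv/= -ler_distl le_min => /andP[_ xr].
  have {}xr : `|x - x0| < r by move: xr r0; lra.
  have := rP x; rewrite /ball_/= distrC => /(_ xr).
  by rewrite -/s0 ltr_distl /Q /q2; nra.
have lower n : g x0 / 2 * q2 ^+ n * (2 * d') <= M * q1 ^+ n * (2 * pi).
  have q1n : 0 <= q1 ^+ n by rewrite exprn_ge0// ltW.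
  have q2n : 0 <= q2 ^+ n by rewrite exprn_ge0// ltW// (lt_trans q10).
  (* Inside the window the integrand is nonnegative, so this bound holds there too, and a cut at x0
     - d' and x0 + d' is enough. *)
  have low x : x \in `[- pi, pi] -> - (M * q1 ^+ n) <= g x * Q s0 x ^+ n.
    move=> xI; have Q0 := peak_ge0 x s01.
    have Qn0 : 0 <= Q s0 x ^+ n by rewrite exprn_ge0.
    have [/gd[_ gx]|/(far _ xI) Qq] := boolP (x \in `[x0 - d, x0 + d]).
      have : 0 <= g x * Q s0 x ^+ n by rewrite mulr_ge0//; lra.
      by have : 0 <= M * q1 ^+ n := mulr_ge0 M0 q1n; lra.
    have : Q s0 x ^+ n <= q1 ^+ n by rewrite lerXn2r// nnegrE// ltW.
    have := gM x xI; rewrite ler_norml => /andP[gx _] Qle.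
    by apply: (@le_trans _ _ (- M * Q s0 x ^+ n)); [rewrite mulNr lerN2 ler_wpM2l|rewrite ler_wpM2r].
  have cQ : continuous (fun x : R => Q s0 x ^+ n).
    have cS : continuous (fun x : R => sin (2^-1 * x) - s0).
      move=> x; apply: cvgB; last exact: cvg_cst.
      exact: continuous_sin_mul.
    move=> x; apply: (@continuous_comp _ _ _ (Q s0) (fun y => y ^+ n)).
      apply: cvgB; first exact: cvg_cst.
      by apply: cvgM; [exact: cvg_cst|apply: cvgM; exact: cS].
    exact: exprn_continuous.
  have int := within_continuous_integrable (L_cont cQ).
  have sub a b : - pi <= a -> b <= pi ->
      mu.-integrable `[a, b] (EFin \o (fun x => g x * Q s0 x ^+ n)).
    move=> a1 b1; apply: integrableS int => //.
    by apply: subset_itv; rewrite bnd_simp.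
  move: (lI) (rI); rewrite !in_itv/= => /andP[l1 l2] /andP[r1 r2].
  have := LQ n; rewrite /L (@Rintegral_segmentD _ _ (x0 - d'))//; [|lra..].
  rewrite (@Rintegral_segmentD _ (x0 - d') (x0 + d'))//; [|lra|lra|by apply: sub; lra].
  have i1 : - (M * q1 ^+ n) * (x0 - d' - - pi) <=
      \int[mu]_(x in `[- pi, x0 - d']) (g x * Q s0 x ^+ n).
    apply: ge_Rintegral; [lra|by apply: sub; lra|].
    by move=> x; rewrite in_itv/= => xI; apply: low; rewrite in_itv/=; lra.
  have i2 : g x0 / 2 * q2 ^+ n * (x0 + d' - (x0 - d')) <=
      \int[mu]_(x in `[x0 - d', x0 + d']) (g x * Q s0 x ^+ n).
    apply: ge_Rintegral; [lra|by apply: sub; lra|].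
    move=> x xI; apply: ler_pM => //; first lra.
      by apply: (gd x _).2; move: xI; rewrite !in_itv/=; lra.
    by rewrite lerXn2r// ?nnegrE ?peak_ge0 ?near_x0// ltW// (lt_trans q10).
  have i3 : - (M * q1 ^+ n) * (pi - (x0 + d')) <=
      \int[mu]_(x in `[x0 + d', pi]) (g x * Q s0 x ^+ n).
    apply: ge_Rintegral; [lra|by apply: sub; lra|].
    by move=> x; rewrite in_itv/= => xI; apply: low; rewrite in_itv/=; lra.
  have : 0 <= M * q1 ^+ n by exact: mulr_ge0.
  by move: i1 i2 i3; set X := M * q1 ^+ n; set Y := g x0 / 2 * q2 ^+ n; nra.
pose z := q1 / q2; have q20 : 0 < q2 by exact: lt_trans q12.
have z1 : `|z| < 1 by rewrite gtr0_norm ?divr_gt0// ltr_pdivrMr// mul1r.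
pose c := g x0 / 2 * (2 * d').
have c0 : 0 < c by rewrite !mulr_gt0// invr_gt0.
have /cvgrPdist_lt := cvg_expr z1.
have B0 : 0 < M * (2 * pi) + 1 by rewrite ltr_wpDl// mulr_ge0// mulr_ge0// ltW.
(* For this N, (q1/q2)^N times 2 pi M is below c, against [lower N]; the added 1 keeps the
   denominator positive when M = 0. *)
move=> /(_ (c / (M * (2 * pi) + 1))); rewrite divr_gt0// => /(_ isT)[N _].
move=> /(_ N (leqnn N)); rewrite /= sub0r normrN ger0_norm; last first.
  by rewrite exprn_ge0// ltW// divr_gt0.
rewrite ltr_pdivlMr// /z expr_div_n.
have q2N : 0 < q2 ^+ N by rewrite exprn_gt0.
rewrite mulrAC ltr_pdivrMr//; have := lower N.
have q1N : 0 <= q1 ^+ N by rewrite exprn_ge0// ltW.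
by rewrite /c; nra.
Qed.

Lemma orthogonal_trig_eq0 :
  (forall k : nat, L (fun x => cos (k%:R * x)) = 0) ->
  (forall k : nat, L (fun x => sin ((k%:R + 2^-1) * x)) = 0) ->
  forall x0, x0 \in `]- pi, pi[ -> g x0 <= 0.
Proof.
move=> h1 h2 x0 x0I; rewrite leNgt; apply/negP => /(peak_contra x0I); apply => n.
have o1 : orth (fun=> 1).
  split; first by move=> x; exact: cvg_cst.
    by move=> k; rewrite -[RHS](h1 k); apply: eq_segment_integral => x _; rewrite mul1r.
  by move=> k; rewrite -[RHS](h2 k); apply: eq_segment_integral => x _; rewrite mul1r.
have [_ /(_ 0%N) <- _] := orth_peakX (sin (2^-1 * x0)) n o1.
by apply: eq_segment_integral => x _; rewrite mul0r cos0 mulr1.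
Qed.

End Completeness.

(** The one-sided bound, applied to g and to -g, gives 0 at interior points, where the peak has room
    on both sides; continuity carries this to the end points. *)
Lemma trig_complete (R : realType) (g : R -> R) :
  {within `[- pi, pi], continuous g} ->
  (forall k : nat,
     \int[lebesgue_measure]_(x in `[- pi, pi]) (g x * cos (k%:R * x)) = 0) ->
  (forall k : nat,
     \int[lebesgue_measure]_(x in `[- pi, pi])
       (g x * sin ((k%:R + 2^-1) * x)) = 0) ->
  forall x, x \in `[- pi, pi] -> g x = 0.
Proof.
move=> cg h1 h2.
have cN : {within `[- pi, pi], continuous (fun x => -1 * g x)}.
  by apply: within_continuousM => //; exact: within_continuous_cst.
have int x : x \in `]- pi, pi[ -> g x = 0.
  move=> xI; apply/eqP; rewrite eq_le orthogonal_trig_eq0//=.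
  rewrite -oppr_le0 -mulN1r.
  apply: (orthogonal_trig_eq0 cN) => // k.
    rewrite -[RHS](mulr0 (-1)) -[in RHS](h1 k) -Rintegral_continuousZ.
      by apply: eq_segment_integral => y _; rewrite mulrA.
    apply: within_continuousM => //; apply: continuous_subspaceT.
    exact: continuous_cos_mul.
  rewrite -[RHS](mulr0 (-1)) -[in RHS](h2 k) -Rintegral_continuousZ.
    by apply: eq_segment_integral => y _; rewrite mulrA.
  apply: within_continuousM => //; apply: continuous_subspaceT.
  exact: continuous_sin_mul.
apply: eq0_on_segment => //; rewrite gtrN ?pi_gt0 //.
Qed.

(** * Orthogonality of sines and cosines *)

Section TrigIntegrals.
Variable R : realType.
Notation mu := (@lebesgue_measure R).

Lemma is_derive_comp_mul (f f' : R -> R) (c x : R) :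
  (forall y : R, is_derive y 1 f (f' y)) ->
  is_derive x 1 (fun y => f (c * y)) (c * f' (c * x)).
Proof.
move=> df; have dc : is_derive x 1 (fun y : R => c * y) c.
  by have := @is_deriveZ R R R id c x 1 1 (is_derive_id x 1); rewrite [c *: 1]mulr1.
by rewrite mulrC; exact: (@is_derive1_comp _ f (fun y => c * y) x _ _ (df _) dc).
Qed.

Lemma is_derive_sin_mul (c x : R) :
  is_derive x 1 (fun y => sin (c * y)) (c * cos (c * x)).
Proof. by apply: (@is_derive_comp_mul sin cos) => y; exact: is_derive_sin. Qed.

Lemma is_derive_cos_mul (c x : R) :
  is_derive x 1 (fun y => cos (c * y)) (- c * sin (c * x)).
Proof.
rewrite mulNr -mulrN.
by apply: (@is_derive_comp_mul cos (fun y => - sin y)) => y; exact: is_derive_cos.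
Qed.

Lemma is_derive_mulc (f : R -> R) (c x l : R) :
  is_derive x 1 f l -> is_derive x 1 (fun y => c * f y) (c * l).
Proof. by move=> df; exact: (@is_deriveZ R R R f c x 1 l df). Qed.

Lemma sin_natmul_pi (k : nat) : sin (k%:R * pi) = 0 :> R.
Proof.
elim: k => [|k IH]; first by rewrite mul0r sin0.
by rewrite -natr1 mulrDl mul1r sinD IH sinpi mul0r mulr0 addr0.
Qed.

Lemma cos_half_natmul_pi (k : nat) : cos ((k%:R + 2^-1) * pi) = 0 :> R.
Proof. by rewrite mulrDl [2^-1 * _]mulrC cosDpihalf sin_natmul_pi oppr0. Qed.

Lemma sin_intmul_pi (m : int) : sin (m%:~R * pi) = 0 :> R.
Proof.
case: m => n; first exact: sin_natmul_pi.
by rewrite NegzE mulrNz mulNr sinN sin_natmul_pi oppr0.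
Qed.

(** The frequency ranges over [int] because product formulas create differences j - k. *)
Lemma Rintegral_cos_int (m : int) :
  \int[mu]_(x in `[- pi, pi]) cos (m%:~R * x) = (m == 0)%:R * (2 * pi).
Proof.
have pi0 := @pi_gt0 R; have pipi : - pi <= pi :> R by lra.
have [->|m0] := eqVneq m 0.
  under eq_segment_integral => x _ do rewrite mul0r cos0.
  by rewrite Rintegral_segment_cst// (_ : true%:R = 1 :> R)//; lra.
have mR : m%:~R != 0 :> R by rewrite intr_eq0.
have dF x : x \in `]- pi, pi[ -> is_derive x 1
    (fun x : R => m%:~R^-1 * sin (m%:~R * x)) (cos (m%:~R * x)).
  move=> _; have := is_derive_mulc (m%:~R^-1) (is_derive_sin_mul m%:~R x).
  by rewrite mulrA mulVf// mul1r.
rewrite (Rintegral_FTC2 pipi _ _ dF).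
- by rewrite mulrN sinN sin_intmul_pi oppr0 !mulr0 subrr mul0r.
- by apply: continuous_subspaceT; exact: continuous_cos_mul.
- apply: within_continuousM; first exact: within_continuous_cst.
  by apply: continuous_subspaceT; exact: continuous_sin_mul.
Qed.

Let cC (c : R) : {within `[- pi, pi], continuous (fun x : R => cos (c * x))}.
Proof. by apply: continuous_subspaceT; exact: continuous_cos_mul. Qed.

Let cS (c : R) : {within `[- pi, pi], continuous (fun x : R => sin (c * x))}.
Proof. by apply: continuous_subspaceT; exact: continuous_sin_mul. Qed.

(** Asking only that a - b and a + b be integers treats integer and half-integer frequencies
    together. *)
Lemma Rintegral_cos_cos (a b : R) (m n : int) :
  a - b = m%:~R -> a + b = n%:~R ->
  \int[mu]_(x in `[- pi, pi]) (cos (a * x) * cos (b * x)) =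
  ((m == 0)%:R + (n == 0)%:R) * pi.
Proof.
move=> hm hn; transitivity (\int[mu]_(x in `[- pi, pi])
    (2^-1 * (cos (m%:~R * x) + cos (n%:~R * x)))).
  apply: eq_segment_integral => x _; rewrite -hm -hn !mulrDl mulNr cosB cosD.
  by lra.
rewrite Rintegral_continuousZ; last exact: within_continuousD.
by rewrite Rintegral_continuousD// !Rintegral_cos_int; lra.
Qed.

Lemma Rintegral_sin_sin (a b : R) (m n : int) :
  a - b = m%:~R -> a + b = n%:~R ->
  \int[mu]_(x in `[- pi, pi]) (sin (a * x) * sin (b * x)) =
  ((m == 0)%:R - (n == 0)%:R) * pi.
Proof.
move=> hm hn; transitivity (\int[mu]_(x in `[- pi, pi])
    (2^-1 * (cos (m%:~R * x) - cos (n%:~R * x)))).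
  apply: eq_segment_integral => x _; rewrite -hm -hn !mulrDl mulNr cosB cosD.
  by lra.
rewrite Rintegral_continuousZ; last exact: within_continuousB.
by rewrite Rintegral_continuousB// !Rintegral_cos_int; lra.
Qed.

(** The integrand is odd, whatever the two frequencies are. *)
Lemma Rintegral_sin_cos (a b : R) :
  \int[mu]_(x in `[- pi, pi]) (sin (a * x) * cos (b * x)) = 0.
Proof.
have pi0 := @pi_ge0 R.
have c : {within `[- pi, pi], continuous (fun x : R => sin (a * x) * cos (b * x))}.
  exact: within_continuousM.
have := Rintegral_opp pi0 c.
under eq_segment_integral => x _ do rewrite !mulrN sinN cosN mulNr -mulN1r.
by rewrite Rintegral_continuousZ//; lra.
Qed.

Let subS (j k : nat) : (j%:Z - k%:Z == 0) = (j == k).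
Proof. by rewrite subr_eq0 eqz_nat. Qed.

(** The second term accounts for the constant function, whose square norm is 2 pi instead of pi. *)
Lemma cos_orthogonal (j k : nat) :
  \int[mu]_(x in `[- pi, pi]) (cos (j%:R * x) * cos (k%:R * x)) =
  ((j == k)%:R + (j + k == 0)%N%:R) * pi.
Proof.
rewrite (@Rintegral_cos_cos _ _ (j%:Z - k%:Z) (j + k)%N%:Z) ?subS//.
  by rewrite rmorphB.
by rewrite -natrD.
Qed.

Lemma sin_orthogonal (j k : nat) :
  \int[mu]_(x in `[- pi, pi]) (sin (j.+1%:R * x) * sin (k.+1%:R * x)) =
  (j == k)%:R * pi.
Proof.
rewrite (@Rintegral_sin_sin _ _ (j.+1%:Z - k.+1%:Z) (j.+1 + k.+1)%N%:Z).
- by rewrite subS eqSS subr0.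
- by rewrite rmorphB.
- by rewrite -natrD.
Qed.

Lemma sin_half_orthogonal (j k : nat) :
  \int[mu]_(x in `[- pi, pi])
    (sin ((j%:R + 2^-1) * x) * sin ((k%:R + 2^-1) * x)) = (j == k)%:R * pi.
Proof.
rewrite (@Rintegral_sin_sin _ _ (j%:Z - k%:Z) (j + k).+1%:Z).
- by rewrite subS subr0.
- by rewrite rmorphB/=; lra.
- by rewrite -pmulrn (_ : (j + k).+1%:R = j%:R + k%:R + 1) -?natrD ?natr1//; lra.
Qed.

Lemma cos_half_orthogonal (j k : nat) :
  \int[mu]_(x in `[- pi, pi])
    (cos ((j%:R + 2^-1) * x) * cos ((k%:R + 2^-1) * x)) = (j == k)%:R * pi.
Proof.
rewrite (@Rintegral_cos_cos _ _ (j%:Z - k%:Z) (j + k).+1%:Z).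
- by rewrite subS addr0.
- by rewrite rmorphB/=; lra.
- by rewrite -pmulrn (_ : (j + k).+1%:R = j%:R + k%:R + 1) -?natrD ?natr1//; lra.
Qed.

End TrigIntegrals.

(** * Integration by parts for an indefinite integral *)

Section AbsolutelyContinuous.
Variable R : realType.
Notation mu := (@lebesgue_measure R).

Lemma integrable_mul_continuous (a b : R) (h f : R -> R) :
  mu.-integrable `[a, b] (EFin \o h) -> {within `[a, b], continuous f} ->
  mu.-integrable `[a, b] (EFin \o (fun x => h x * f x)).
Proof.
move=> ih cf; have [M M0 fM] := within_continuous_bounded cf.
have mf : measurable_fun `[a, b] f.
  by have /measurable_int/measurable_EFinP := within_continuous_integrable cf.
apply: eq_integrable (integrableMl _ ih mf _) => //.
exists M; split; first exact: num_real.
by move=> y My x xI /=; apply: le_trans (ltW My); exact: fM.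
Qed.

(* Adding up over a partition into [n] equal parts bounds the increment by
   [(b - a) / n * (W b - W a)]. *)
Lemma eq_of_product_increments (a b : R) (H W : R -> R) : a <= b ->
  (forall x y, a <= x -> x <= y -> y <= b ->
     `|H y - H x| <= (y - x) * (W y - W x)) ->
  H a = H b.
Proof.
move=> ab HW; apply/eqP; rewrite eq_sym -subr_eq0 -normr_eq0 eq_le normr_ge0 andbT.
have part n : `|H b - H a| <= (b - a) / n.+1%:R * (W b - W a).
  pose p (i : nat) := a + i%:R * ((b - a) / n.+1%:R).
  have d0 : 0 <= (b - a) / n.+1%:R by rewrite divr_ge0 ?subr_ge0.
  have p0 : p 0%N = a by rewrite /p mul0r addr0.
  have pn : p n.+1 = b by rewrite /p mulrC divfK// addrC subrK.
  have pS i : p i.+1 - p i = (b - a) / n.+1%:R.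
    by rewrite /p -[i.+1%:R]natr1 mulrDl mul1r; set u := _ / _; lra.
  have tel (f : R -> R) : f b - f a = \sum_(i < n.+1) (f (p i.+1) - f (p i)).
    by rewrite -(big_mkord xpredT (fun i => f (p i.+1) - f (p i)))
      (telescope_sumr (f \o p))//= p0 pn.
  rewrite (tel H) (tel W) mulr_sumr; apply: (le_trans (ler_norm_sum _ _ _)).
  apply: ler_sum => i _; rewrite -(pS i); apply: HW.
  - by rewrite lerDl mulr_ge0.
  - by rewrite -subr_ge0 pS.
  - by rewrite -pn lerD2l ler_wpM2r// ler_nat.
apply/ler_addgt0Pr => e e0; rewrite add0r.
have B0 : 0 <= (b - a) * (W b - W a).
  by rewrite (le_trans _ (HW a b _ _ _)).
pose n := Num.truncn (((b - a) * (W b - W a)) / e).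
apply: (le_trans (part n)); rewrite mulrAC ler_pdivrMr// [e * _]mulrC -ler_pdivrMr//.
by apply/ltW; rewrite -truncn_le_nat// ?divr_ge0// ltW.
Qed.

(** [G] may have no derivative at some points, so the defect [H] of the formula, as a function of
    the upper limit, is shown to be constant through its increments: on [x, y] they are at most (y -
    x) times 2 K times the integral of |h|. *)
Lemma abs_cont_by_parts (a b : R) (h G E E' : R -> R) : a <= b ->
  mu.-integrable `[a, b] (EFin \o h) -> {within `[a, b], continuous G} ->
  (forall x, x \in `[a, b] -> G x = G a + \int[mu]_(y in `[a, x]) h y) ->
  (forall x : R, is_derive x 1 E (E' x)) -> continuous E' ->
  \int[mu]_(x in `[a, b]) (G x * E' x) =
    G b * E b - G a * E a - \int[mu]_(x in `[a, b]) (h x * E x).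
Proof.
move=> ab ih cG Gh dE cE'.
have cE : continuous E := is_derive_continuous dE.
have [K K0 E'K] := within_continuous_bounded (continuous_subspaceT cE' : {within `[a, b], continuous E'}).
have sub (f : R -> R) x y : mu.-integrable `[a, b] (EFin \o f) ->
    a <= x -> y <= b -> mu.-integrable `[x, y] (EFin \o f).
  by move=> fi ax yb; apply: integrableS fi => //; apply: subset_itv; rewrite bnd_simp.
have ihE : mu.-integrable `[a, b] (EFin \o (fun x => h x * E x)).
  by apply: integrable_mul_continuous => //; exact: continuous_subspaceT.
have iGE : mu.-integrable `[a, b] (EFin \o (fun x => G x * E' x)).
  apply: within_continuous_integrable; apply: within_continuousM => //.
  exact: continuous_subspaceT.
have iah : mu.-integrable `[a, b] (EFin \o (fun x => `|h x|)).
  exact: integrable_norm ih.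
pose H x := G x * E x - \int[mu]_(y in `[a, x]) (h y * E y)
  - \int[mu]_(y in `[a, x]) (G y * E' y).
pose W x := 2 * K * \int[mu]_(y in `[a, x]) `|h y|.
suff : H a = H b.
  by rewrite /H !set_itv1 !Rintegral_set1; lra.
apply: (@eq_of_product_increments _ _ H W) => // x y ax xy yb.
have ay := le_trans ax xy; have xb := le_trans xy yb.
have split (f : R -> R) : mu.-integrable `[a, b] (EFin \o f) ->
    \int[mu]_(s in `[a, y]) f s =
    \int[mu]_(s in `[a, x]) f s + \int[mu]_(s in `[x, y]) f s.
  by move=> fi; apply: Rintegral_segmentD => //; exact: sub.
have xyab s : s \in `[x, y] -> s \in `[a, b].
  rewrite !in_itv/= => /andP[xs sy].
  by rewrite (le_trans ax xs) (le_trans sy yb).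
have Gxy s : s \in `[x, y] -> G s - G x = \int[mu]_(r in `[x, s]) h r.
  move=> sI; have := sI; rewrite in_itv/= => /andP[xs sy].
  rewrite (Gh s (xyab _ sI)) (Gh x) ?in_itv/= ?ax//.
  rewrite (@Rintegral_segmentD _ a x s)//; last by apply: sub => //; exact: le_trans yb.
  by lra.
pose V := \int[mu]_(s in `[x, y]) `|h s|.
have V0 : 0 <= V by apply: Rintegral_ge0.
have GV s : s \in `[x, y] -> `|G x - G s| <= V.
  move=> sI; have := sI; rewrite in_itv/= => /andP[xs sy].
  rewrite distrC Gxy//.
  have sb : s <= b := le_trans sy yb.
  apply: (le_trans (le_normr_Rintegral _ (sub _ _ _ ih ax sb))) => //.
  rewrite /V (@Rintegral_segmentD _ x s y)//; last exact: sub.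
  by rewrite lerDl Rintegral_ge0.
have iE1 : mu.-integrable `[x, y] (EFin \o (fun s => h s * (E y - E s))).
  apply: integrable_mul_continuous; first exact: sub.
  apply: within_continuousB; first exact: within_continuous_cst.
  exact: continuous_subspaceT.
have iE2 : mu.-integrable `[x, y] (EFin \o (fun s => (G x - G s) * E' s)).
  apply: within_continuous_integrable; apply: within_continuousM.
    apply: within_continuousB; first exact: within_continuous_cst.
    by apply: continuous_subspaceW cG => s; exact: xyab.
  exact: continuous_subspaceT.
have cE'xy : {within `[x, y], continuous E'} by exact: continuous_subspaceT.
(* Freezing [E] at y and [G] at x leaves two integrals, each with two small factors: |E y - E s| <=
   K (y - x) beside [h], and |G x - G s| <= V on an interval of length y - x. This is the origin of
   the 2 in [W]. *)
have eH : H y - H x = \int[mu]_(s in `[x, y]) (h s * (E y - E s)) +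
    \int[mu]_(s in `[x, y]) ((G x - G s) * E' s).
  have -> : \int[mu]_(s in `[x, y]) (h s * (E y - E s)) =
      E y * (G y - G x) - \int[mu]_(s in `[x, y]) (h s * E s).
    rewrite Gxy ?in_itv/= ?xy ?lexx// -RintegralZl//; last exact: sub.
    rewrite -RintegralB//; last exact: sub.
      by apply: eq_segment_integral => s _; rewrite mulrBr [E y * _]mulrC.
    by apply: (@integrableZl _ _ _ mu _ _ (E y) (EFin \o h)) => //; exact: sub.
  have -> : \int[mu]_(s in `[x, y]) ((G x - G s) * E' s) =
      G x * (E y - E x) - \int[mu]_(s in `[x, y]) (G s * E' s).
    rewrite -(@Rintegral_FTC2 _ x y E' E)//; last exact: continuous_subspaceT.
    rewrite -RintegralZl//; last exact: within_continuous_integrable.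
    rewrite -RintegralB//; last exact: sub.
      by apply: eq_segment_integral => s _; rewrite mulrBl.
    apply: within_continuous_integrable; apply: within_continuousM => //.
    exact: within_continuous_cst.
  by rewrite /H (split _ ihE) (split _ iGE); lra.
have -> : (y - x) * (W y - W x) = (y - x) * K * V + V * K * (y - x).
  by rewrite /W (split _ iah) -/V; lra.
rewrite eH; apply: (le_trans (ler_normD _ _)); apply: lerD.
  apply: (le_trans (le_normr_Rintegral _ iE1)) => //.
  rewrite /V -RintegralZl//; last exact: sub.
  apply: le_Rintegral => //; first exact: integrable_norm iE1.
    by apply: (@integrableZl _ _ _ mu _ _ ((y - x) * K) (EFin \o (fun s => `|h s|))) => //; exact: sub.
  move=> s sI; rewrite normrM mulrC ler_wpM2r//.
  have := sI; rewrite /= in_itv/= => /andP[xs sy].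
  have -> : (y - x) * K = K * (y - x) by rewrite mulrC.
  apply: (@le_trans _ _ (K * `|y - s|)).
    apply: (derivative_bound_lipschitz dE) => z; rewrite min_l// max_r// => zI.
    by apply/E'K/xyab; move: zI; rewrite !in_itv/= => /andP[/(le_trans xs)-> ->].
  by rewrite ler_wpM2l// ger0_norm ?subr_ge0// lerB.
apply: normr_Rintegral_le => // s sI.
by rewrite normrM ler_pM// ?GV// E'K// xyab.
Qed.

End AbsolutelyContinuous.

(** * Bessel's inequality and square summability *)

Section Bessel.
Variable R : realType.
Notation mu := (@lebesgue_measure R).

Lemma cvg_series_bounded_sums (a : nat -> R) (B : R) : (forall k, 0 <= a k) ->
  (forall n, \sum_(k < n) a k <= B) -> cvgn (series a).
Proof.
move=> a0 aB; apply: nondecreasing_is_cvgn.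
  by apply: nondecreasing_series => *; exact: a0.
by exists B => _ [n _ <-]; rewrite /series/= big_mkord.
Qed.

Lemma sum_inv_sqr_le (n : nat) : \sum_(k < n) (k.+1%:R ^+ 2)^-1 <= 2 :> R.
Proof.
case: n => [|n]; first by rewrite big_ord0.
(* The strengthened bound telescopes: 1/(x+1)^2 <= 1/x - 1/(x+1). *)
suff : \sum_(k < n.+1) (k.+1%:R ^+ 2)^-1 <= 2 - n.+1%:R^-1 :> R.
  by move=> /le_trans; apply; rewrite lerBlDr lerDl invr_ge0.
elim: n => [|n IH]; first by rewrite big_ord1 expr1n !invr1; lra.
rewrite big_ord_recr/=; apply: (le_trans (lerD IH (lexx _))).
set x : R := n.+1%:R; have x0 : 0 < x by rewrite ltr0n.
have -> : n.+2%:R = x + 1 by rewrite natr1.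
have x1 : 0 < (x + 1)^-1 by rewrite invr_gt0; lra.
have : x^-1 - (x + 1)^-1 = x^-1 * (x + 1)^-1.
  by field; apply/andP; split; rewrite gt_eqF//; lra.
have vu : (x + 1)^-1 <= x^-1 by rewrite lef_pV2 ?posrE; lra.
have : (x + 1)^-1 * (x + 1)^-1 <= x^-1 * (x + 1)^-1 by rewrite ler_pM2r.
by rewrite -exprVn expr2; set v := (x + 1)^-1; set u := x^-1; lra.
Qed.

(** A segment has finite measure, and |h| <= 1 + h^2. *)
Lemma sqr_integrable_integrable (a b : R) (h : R -> R) :
  measurable_fun `[a, b] h ->
  (\int[mu]_(x in `[a, b]) ((h x) ^+ 2)%:E < +oo)%E ->
  mu.-integrable `[a, b] (EFin \o h) /\
  mu.-integrable `[a, b] (EFin \o (fun x => h x ^+ 2)).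
Proof.
move=> mh h2; have ih2 : mu.-integrable `[a, b] (EFin \o (fun x => h x ^+ 2)).
  apply/integrableP; split; first by apply/measurable_EFinP; exact: measurable_funX.
  apply: le_lt_trans h2; rewrite le_eqVlt; apply/orP; left; apply/eqP.
  by apply: eq_integral => x _; rewrite /= ger0_norm ?sqr_ge0.
split => //.
have i1 : mu.-integrable `[a, b] (EFin \o (fun x : R => 1 + h x ^+ 2)).
  apply: (@integrableD _ _ _ mu _ _ (EFin \o (fun=> 1)) (EFin \o (fun x => h x ^+ 2))) => //.
  by apply: within_continuous_integrable; exact: within_continuous_cst.
apply: le_integrable i1 => //; first exact/measurable_EFinP.
move=> x _ /=; rewrite lee_fin [leRHS]ger0_norm ?addr_ge0 ?sqr_ge0//.
by rewrite -real_normK ?num_real//; have := normr_ge0 (h x); nra.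
Qed.

(** Expand the nonnegative integral of (h - S n)^2, where [S n] is the orthogonal projection of [h]:
    both the integral of h S n and that of (S n)^2 equal c times the sum of the squared
    coefficients. *)
Lemma bessel (a b c : R) (h : R -> R) (s : nat -> R -> R) : 0 < c ->
  mu.-integrable `[a, b] (EFin \o h) ->
  mu.-integrable `[a, b] (EFin \o (fun x => h x ^+ 2)) ->
  (forall k, {within `[a, b], continuous (s k)}) ->
  (forall j k, \int[mu]_(x in `[a, b]) (s j x * s k x) = (j == k)%:R * c) ->
  forall n, \sum_(k < n) (c^-1 * \int[mu]_(x in `[a, b]) (h x * s k x)) ^+ 2 <=
    c^-1 * \int[mu]_(x in `[a, b]) (h x ^+ 2).
Proof.
move=> c0 ih ih2 cs orth n.
pose d k := c^-1 * \int[mu]_(x in `[a, b]) (h x * s k x).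
pose S n x := \sum_(k < n) d k * s k x.
have cS m : {within `[a, b], continuous (S m)}.
  elim: m => [|m IH].
    by rewrite (_ : S 0%N = fun=> 0); [exact: within_continuous_cst|apply/funext => x; rewrite /S big_ord0].
  rewrite (_ : S m.+1 = fun x => S m x + d m * s m x); last first.
    by apply/funext => x; rewrite /S big_ord_recr.
  apply: within_continuousD => //; apply: within_continuousM => //.
  exact: within_continuous_cst.
(* [g] is general because this is used with [h], with [S n] and, after exchanging the factors, with
   each [s k]. *)
have linS (g : R -> R) m :
    (forall k, mu.-integrable `[a, b] (EFin \o (fun x => g x * s k x))) ->
    (forall k, mu.-integrable `[a, b] (EFin \o (fun x => g x * S k x))) ->
    \int[mu]_(x in `[a, b]) (g x * S m x) =
    \sum_(k < m) d k * \int[mu]_(x in `[a, b]) (g x * s k x).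
  move=> igs igS; elim: m => [|m IH].
    rewrite big_ord0; under eq_segment_integral => x _ do rewrite /S big_ord0 mulr0.
    by rewrite /Rintegral integral0.
  rewrite big_ord_recr/= -IH -RintegralZl// -RintegralD//.
    by apply: eq_segment_integral => x _; rewrite /S big_ord_recr/= mulrDr mulrCA.
  exact: (@integrableZl _ _ _ mu _ _ (d m) (EFin \o (fun x => g x * s m x))).
have ihs (f : R -> R) : {within `[a, b], continuous f} ->
    mu.-integrable `[a, b] (EFin \o (fun x => h x * f x)).
  by move=> cf; exact: integrable_mul_continuous.
have iS (f g : R -> R) : {within `[a, b], continuous f} ->
   {within `[a, b], continuous g} -> mu.-integrable `[a, b] (EFin \o (fun x => f x * g x)).
  by move=> cf cg; apply: within_continuous_integrable; exact: within_continuousM.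
have hS : \int[mu]_(x in `[a, b]) (h x * S n x) = c * \sum_(k < n) d k ^+ 2.
  rewrite linS; [|by move=> k; exact: ihs..].
  rewrite mulr_sumr; apply: eq_bigr => k _.
  have -> : \int[mu]_(x in `[a, b]) (h x * s k x) = c * d k.
    by rewrite /d mulrA divff ?mul1r// gt_eqF.
  by lra.
have SS : \int[mu]_(x in `[a, b]) (S n x * S n x) = c * \sum_(k < n) d k ^+ 2.
  rewrite linS; [|by move=> k; exact: iS..].
  rewrite mulr_sumr; apply: eq_bigr => k _.
  under eq_segment_integral => x _ do rewrite mulrC.
  rewrite linS; [|by move=> j; exact: iS..].
  rewrite (bigD1 k)//= big1 ?addr0; last first.
    by move=> j jk; rewrite orth (_ : _ == _ = false) ?mul0r ?mulr0//; apply/negbTE; rewrite eq_sym.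
  by rewrite orth eqxx mul1r; lra.
have i2hS : mu.-integrable `[a, b] (EFin \o (fun x => 2 * (h x * S n x))).
  by apply: (@integrableZl _ _ _ mu _ _ 2 (EFin \o (fun x => h x * S n x))) => //; exact: ihs.
have : 0 <= \int[mu]_(x in `[a, b]) ((h x - S n x) ^+ 2).
  by apply: Rintegral_ge0 => x _; exact: sqr_ge0.
have -> : \int[mu]_(x in `[a, b]) ((h x - S n x) ^+ 2) =
   \int[mu]_(x in `[a, b]) (h x ^+ 2) - 2 * (c * \sum_(k < n) d k ^+ 2) +
   c * \sum_(k < n) d k ^+ 2.
  rewrite -{1}hS -SS -RintegralZl//; last exact: ihs.
  rewrite -RintegralB// -RintegralD//; last 2 first.
  - exact: (@integrableB _ _ _ mu _ _ (EFin \o (fun x => h x ^+ 2)) (EFin \o (fun x => 2 * (h x * S n x)))).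
  - exact: iS.
  by apply: eq_segment_integral => x _; lra.
by rewrite ler_pdivlMl// => ?; lra.
Qed.

End Bessel.

(** * Neumann eigenfunctions and coefficients of the data *)

Section Eigenfunctions.
Variable R : realType.
Notation mu := (@lebesgue_measure R).

(* [sg] is the parity (1 or -1) of the Neumann eigenfunction [e], with
   eigenvalue [nu ^+ 2]. *)
Definition eigenfun (nu sg : R) (e de : R -> R) : Prop :=
  [/\ forall x : R, is_derive x 1 e (de x),
      forall x : R, is_derive x 1 de (- nu ^+ 2 * e x),
      forall x, e (- x) = sg * e x,
      de (- pi) = 0 & de pi = 0].

Lemma eigenfun_cos (k : nat) : eigenfun k%:R 1 (fun x => cos (k%:R * x))
  (fun x => - k%:R * sin (k%:R * x)).
Proof.
split.
- by move=> x; exact: is_derive_cos_mul.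
- move=> x; have := is_derive_mulc (- k%:R) (is_derive_sin_mul k%:R x).
  by rewrite mulrA mulNr -expr2.
- by move=> x; rewrite mulrN cosN mul1r.
- by rewrite mulrN sinN sin_natmul_pi oppr0 mulr0.
- by rewrite sin_natmul_pi mulr0.
Qed.

Lemma eigenfun_sin (k : nat) : eigenfun (k%:R + 2^-1) (- 1)
  (fun x => sin ((k%:R + 2^-1) * x))
  (fun x => (k%:R + 2^-1) * cos ((k%:R + 2^-1) * x)).
Proof.
split.
- by move=> x; exact: is_derive_sin_mul.
- move=> x; have := is_derive_mulc (k%:R + 2^-1) (is_derive_cos_mul (k%:R + 2^-1) x).
  by rewrite mulrA mulrN -expr2.
- by move=> x; rewrite mulrN sinN mulN1r.
- by rewrite mulrN cosN cos_half_natmul_pi mulr0.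
- by rewrite cos_half_natmul_pi mulr0.
Qed.

(** The integrand is the derivative of u1 e - u de. The radius is kept free: r = pi serves the data,
    r < pi the truncated modes of a solution, where boundary terms remain. *)
Lemma green_identity (r : R) (nu sg : R) (e de u u1 u2 : R -> R) : 0 <= r ->
  eigenfun nu sg e de ->
  {within `[- r, r], continuous u} -> {within `[- r, r], continuous u1} ->
  {within `[- r, r], continuous u2} ->
  (forall x, x \in `]- r, r[ -> is_derive x 1 u (u1 x)) ->
  (forall x, x \in `]- r, r[ -> is_derive x 1 u1 (u2 x)) ->
  \int[mu]_(x in `[- r, r]) (u2 x * e x) +
    nu ^+ 2 * \int[mu]_(x in `[- r, r]) (u x * e x) =
  (u1 r * e r - u r * de r) - (u1 (- r) * e (- r) - u (- r) * de (- r)).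
Proof.
move=> r0 [de1 de2 _ _ _] cu cu1 cu2 du du1.
have rr : - r <= r by lra.
have ce : {within `[- r, r], continuous e} := is_derive_within_continuous de1.
have cde : {within `[- r, r], continuous de} := is_derive_within_continuous de2.
rewrite -Rintegral_continuousZ; last exact: within_continuousM.
rewrite -Rintegral_continuousD; last 2 first.
- exact: within_continuousM.
- apply: within_continuousM; first exact: within_continuous_cst.
  exact: within_continuousM.
have dF x : x \in `]- r, r[ -> is_derive x 1 (fun x => u1 x * e x - u x * de x)
    (u2 x * e x + nu ^+ 2 * (u x * e x)).
  move=> xI; have d1 := du1 x xI; have d2 := du x xI.
  have d3 := de1 x; have d4 := de2 x.
  have d5 := is_deriveM d1 d3; have d6 := is_deriveM d2 d4.
  apply: (is_derive_eq (is_deriveB d5 d6)); rewrite /GRing.scale/=; lra.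
rewrite (Rintegral_FTC2 rr _ _ dF)//.
- apply: within_continuousD; first exact: within_continuousM.
  apply: within_continuousM; first exact: within_continuous_cst.
  exact: within_continuousM.
- by apply: within_continuousB; exact: within_continuousM.
Qed.

Lemma Ipi_nbhs (x : R) : - pi < x < pi -> nbhs x (@Ipi R).
Proof.
move=> xI; have := @near_in_itvoo R (- pi) pi x; rewrite in_itv/= => /(_ xI).
by apply: filterS => y /subset_itv_oo_cc.
Qed.

Lemma C2_H3_continuous (phi phi1 phi2 phi3 : R -> R) :
  C2_H3_data phi phi1 phi2 phi3 ->
  [/\ {within `[- pi, pi], continuous phi},
      {within `[- pi, pi], continuous phi1} &
      {within `[- pi, pi], continuous phi2}].
Proof.
move=> [d1 [d2 [c2 _]]]; split => //.
- exact: deriv_within_continuous d1.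
- exact: deriv_within_continuous d2.
Qed.

(* Two integrations by parts against [e] and a third one against [de]. *)
Lemma C2_H3_coef (nu sg : R) (e de phi phi1 phi2 phi3 : R -> R) : nu != 0 ->
  eigenfun nu sg e de -> C2_H3_data phi phi1 phi2 phi3 ->
  phi1 (- pi) = 0 -> phi1 pi = 0 ->
  \int[mu]_(x in `[- pi, pi]) (phi x * e x) =
  - (nu ^+ 4)^-1 * \int[mu]_(x in `[- pi, pi]) (phi3 x * de x).
Proof.
move=> nu0 he dphi phil phir; have [c0 c1 c2] := C2_H3_continuous dphi.
have [d1 [d2 [_ [m3 [i3 phi23]]]]] := dphi.
have [de1 de2 _ deNpi depi] := he.
have pi0 := @pi_ge0 R; have pipi : - pi <= pi :> R by lra.
have nu20 : nu ^+ 2 != 0 by rewrite expf_neq0.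
have := green_identity pi0 he c0 c1 c2.
rewrite phil phir deNpi depi !mul0r !mulr0 !subr0 => green.
have {green} : \int[mu]_(x in `[- pi, pi]) (phi2 x * e x) +
    nu ^+ 2 * \int[mu]_(x in `[- pi, pi]) (phi x * e x) = 0.
  apply: green => x; rewrite in_itv/= => xI.
    apply: deriv_within_is_derive (d1 x _); first exact: Ipi_nbhs.
    by apply: subset_itv_oo_cc; rewrite /= in_itv.
  apply: deriv_within_is_derive (d2 x _); first exact: Ipi_nbhs.
  by apply: subset_itv_oo_cc; rewrite /= in_itv.
have [ih _] := sqr_integrable_integrable m3 i3.
have ce : continuous e := is_derive_continuous de1.
have dE (x : R) : is_derive x 1 (fun x => - (nu ^+ 2)^-1 * de x) (e x).
  have := is_derive_mulc (- (nu ^+ 2)^-1) (de2 x).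
  by rewrite mulrA mulrNN mulVf// mul1r.
rewrite (abs_cont_by_parts pipi ih c2 phi23 dE ce) deNpi depi !mulr0 subrr sub0r.
have -> : \int[mu]_(x in `[- pi, pi]) (phi3 x * (- (nu ^+ 2)^-1 * de x)) =
    - (nu ^+ 2)^-1 * \int[mu]_(x in `[- pi, pi]) (phi3 x * de x).
  rewrite -RintegralZl//; last first.
    by apply: integrable_mul_continuous => //; exact: is_derive_within_continuous de2.
  by apply: eq_segment_integral => x _; rewrite mulrCA.
set A := \int[mu]_(x in _) _; set B := \int[mu]_(x in _) _ => AB.
have -> : (nu ^+ 4)^-1 = (nu ^+ 2)^-1 * (nu ^+ 2)^-1 by rewrite -invfM -exprD.
apply: (mulfI nu20); rewrite mulrA mulrN mulrA divff// mul1r; lra.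
Qed.

End Eigenfunctions.

(** * Continuity in two variables and integrals with a parameter *)

Section TwoVariables.
Variable R : realType.
Notation mu := (@lebesgue_measure R).
Implicit Types (w : R -> R -> R) (A : set (R * R)).

Lemma within_continuous2P A w :
  {within A, continuous (fun p : R * R => w p.1 p.2)} <->
  forall x t, A (x, t) -> forall e, 0 < e -> exists2 d, 0 < d &
    forall x' t', `|x' - x| < d -> `|t' - t| < d -> A (x', t') ->
      `|w x' t' - w x t| < e.
Proof.
split=> [/subspace_continuousP cw x t Axt e e0|cw].
  have /cvgrPdist_lt/(_ e e0)/nbhs_ballP[d /= d0 dP] := cw _ Axt.
  exists d => // x' t' xx' tt' Axt'; rewrite distrC.
  by apply: (dP (x', t')) => //; split; rewrite /ball/= distrC.
apply/subspace_continuousP => -[x t] Axt; apply/cvgrPdist_lt => e e0.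
have [d d0 dP] := cw x t Axt e e0; apply/nbhs_ballP; exists d => //= -[x' t'].
move=> [/= xx' tt'] Axt'; rewrite distrC; apply: dP => //.
  by rewrite distrC.
by rewrite distrC.
Qed.

Lemma within_continuous1P (D : set R) (g : R -> R) :
  {within D, continuous g} <->
  forall x, D x -> forall e, 0 < e -> exists2 d, 0 < d &
    forall x', `|x' - x| < d -> D x' -> `|g x' - g x| < e.
Proof.
split=> [/subspace_continuousP cw x Dx e e0|cw].
  have /cvgrPdist_lt/(_ e e0)/nbhs_ballP[d /= d0 dP] := cw _ Dx.
  by exists d => // x' xx' Dx'; rewrite distrC; apply: dP => //; rewrite /ball/= distrC.
apply/subspace_continuousP => x Dx; apply/cvgrPdist_lt => e e0.
have [d d0 dP] := cw x Dx e e0; apply/nbhs_ballP; exists d => //= x' xx' Dx'.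
by rewrite distrC; apply: dP => //; rewrite distrC.
Qed.

Lemma slice_continuous A w (D : set R) t :
  {within A, continuous (fun p : R * R => w p.1 p.2)} ->
  (forall x, D x -> A (x, t)) -> {within D, continuous (w ^~ t)}.
Proof.
move=> /within_continuous2P cw DA; apply/within_continuous1P => x Dx e e0.
have [d d0 dP] := cw x t (DA x Dx) e e0; exists d => // x' xx' Dx'.
by apply: dP => //; [rewrite subrr normr0|exact: DA].
Qed.

(** Lets [continuous_param_uniform] be used with compactness in time and a limit in space. *)
Lemma swap_continuous A w :
  {within A, continuous (fun p : R * R => w p.1 p.2)} ->
  {within [set p | A (p.2, p.1)], continuous (fun p : R * R => w p.2 p.1)}.
Proof.
move=> /within_continuous2P cw.
apply/(within_continuous2P _ (fun x t => w t x)) => x t /= Axt e e0.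
have [d d0 dP] := cw t x Axt e e0; exists d => // x' t' xx' tt'.
exact: dP.
Qed.

(** Compactness of [K] turns the moduli of continuity at the points (x, t) into one that is uniform
    in x. *)
Lemma continuous_param_uniform A w (K J : set R) t e : compact K -> J t ->
  0 < e -> {within A, continuous (fun p : R * R => w p.1 p.2)} ->
  (forall x s, K x -> J s -> A (x, s)) ->
  exists2 d, 0 < d & forall s, `|s - t| < d -> J s ->
    forall x, K x -> `|w x s - w x t| < e.
Proof.
move=> /compact_near_coveringP/near_covering_withinP cK Jt e0.
move=> /within_continuous2P cw KJ.
have [x Kx|d /= d0 dP] := cK _ (nbhs t)
    (fun s x => J s -> `|w x s - w x t| < e) (nbhs_filter t).
  have e20 : 0 < e / 2 by rewrite divr_gt0.
  have [d d0 dP] := cw x t (KJ _ _ Kx Jt) _ e20.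
  exists (ball x d, ball t d) => /=; first by split; exact: nbhsx_ballx.
  move=> [x' s] /= [xx' ts] Kx' Js.
  have xd : `|x' - x| < d by rewrite distrC.
  have h1 : `|w x' s - w x t| < e / 2.
    by apply: dP => //; [rewrite distrC|exact: KJ].
  have h2 : `|w x' t - w x t| < e / 2.
    by apply: dP => //; [rewrite subrr normr0|exact: KJ].
  by move: h1 h2; rewrite !ltr_distl; lra.
by exists d => // s sd Js x Kx; apply: (dP s) => //; rewrite /ball_/= distrC.
Qed.

(** The order of x and y is left open because the increment in a difference quotient has either
    sign. *)
Lemma mvt_between (f df : R -> R) (x y : R) :
  (forall z : R, Num.min x y <= z <= Num.max x y -> is_derive z 1 f (df z)) ->
  exists z : R, [/\ Num.min x y <= z <= Num.max x y, `|z - x| <= `|y - x| &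
    f y - f x = df z * (y - x)].
Proof.
have key (a b : R) : a <= b ->
    (forall z : R, a <= z <= b -> is_derive z 1 f (df z)) ->
    exists2 z, a <= z <= b & f b - f a = df z * (b - a).
  move=> ab dab; have [||z zab ->] := @MVT_segment R f df a b ab.
  - by move=> z zab; apply: dab; have := subset_itv_oo_cc zab; rewrite in_itv.
  - by apply: derivable_within_continuous => z; rewrite in_itv/= => /dab[].
  - by exists z => //; move: zab; rewrite in_itv.
have [xy|yx] := leP x y => dxy.
  have [z zI zE] := key _ _ xy dxy; exists z; split => //.
  by rewrite !ger0_norm; lra.
have [z zI zE] := key _ _ (ltW yx) dxy; exists z; split => //; last by lra.
by rewrite ler0_norm ?ltr0_norm; lra.
Qed.

Lemma Rintegral_param_continuous A w (a b : R) (J : set R) : a <= b ->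
  {within A, continuous (fun p : R * R => w p.1 p.2)} ->
  (forall x s, x \in `[a, b] -> J s -> A (x, s)) ->
  {within J, continuous (fun t => \int[mu]_(x in `[a, b]) w x t)}.
Proof.
move=> ab cw KJ; apply/within_continuous1P => t Jt e e0.
have D0 : 0 < b - a + 1 by lra.
have e10 : 0 < e / (b - a + 1) by rewrite divr_gt0.
have cs s : J s -> {within `[a, b], continuous (w ^~ s)}.
  by move=> Js; apply: slice_continuous cw _ => x xI; exact: KJ.
have [d d0 dP] := continuous_param_uniform (@segment_compact R a b) Jt e10 cw KJ.
exists d => // s sd Js; rewrite -Rintegral_continuousB; [|exact: cs..].
apply: (@le_lt_trans _ _ (e / (b - a + 1) * (b - a))).
  apply: normr_Rintegral_le => //.
    by apply: within_continuous_integrable; apply: within_continuousB; exact: cs.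
  by move=> x xI; apply/ltW; exact: dP.
by rewrite mulrAC ltr_pdivrMr// ltr_pM2l//; lra.
Qed.

(** The difference quotient of [w x] is the value of [wt x] at an intermediate time, which is close
    to [wt x t] uniformly in x. The time interval is open, as u_t is controlled only for 0 < t <
    T. *)
Lemma is_derive_Rintegral_param w wt (a b c d t : R) (g : R -> R) : a <= b ->
  c < t < d ->
  {within [set p | a <= p.1 <= b /\ c < p.2 < d],
    continuous (fun p : R * R => w p.1 p.2)} ->
  {within [set p | a <= p.1 <= b /\ c < p.2 < d],
    continuous (fun p : R * R => wt p.1 p.2)} ->
  (forall x s, a <= x <= b -> c < s < d -> is_derive s 1 (w x) (wt x s)) ->
  {within `[a, b], continuous g} ->
  is_derive t 1 (fun s => \int[mu]_(x in `[a, b]) (w x s * g x))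
    (\int[mu]_(x in `[a, b]) (wt x t * g x)).
Proof.
move=> ab ctd cw cwt dw cg.
have [M M0 gM] := within_continuous_bounded cg.
have cws s : c < s < d -> {within `[a, b], continuous (fun x => w x s * g x)}.
  move=> cs; apply: within_continuousM => //; apply: slice_continuous cw _ => x.
  by rewrite /= in_itv/=.
have cwts : {within `[a, b], continuous (fun x => wt x t * g x)}.
  apply: within_continuousM => //; apply: slice_continuous cwt _ => x.
  by rewrite /= in_itv/=.
have nt : nbhs t [set s : R | c < s < d].
  have := @near_in_itvoo R c d t; rewrite in_itv/= => /(_ ctd).
  by apply: filterS => s; rewrite /= in_itv.
apply: (deriv_within_is_derive nt); apply/deriv_withinP => e e0.
have D0 : 0 < M * (b - a) + 1 by rewrite ltr_wpDl// mulr_ge0//; lra.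
have e10 : 0 < e / (M * (b - a) + 1) by rewrite divr_gt0.
have [r r0 rP] := continuous_param_uniform (J := [set s | c < s < d])
  (@segment_compact R a b) ctd e10 cwt
  (fun x s (xI : x \in `[a, b]) (Js : c < s < d) => conj xI Js).
exists r => // h hr cth h0.
pose q x := h^-1 * (w x (t + h) * g x - w x t * g x) - wt x t * g x.
have cq0 : {within `[a, b], continuous (fun x => w x (t + h) * g x - w x t * g x)}.
  by apply: within_continuousB; exact: cws.
have cq1 : {within `[a, b], continuous (fun x => h^-1 * (w x (t + h) * g x - w x t * g x))}.
  by apply: within_continuousM => //; exact: within_continuous_cst.
rewrite -Rintegral_continuousB; [|exact: cws..].
rewrite -Rintegral_continuousZ// -Rintegral_continuousB//.
apply: (@le_lt_trans _ _ (e / (M * (b - a) + 1) * M * (b - a))).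
  apply: normr_Rintegral_le => //.
    by apply: within_continuous_integrable; exact: within_continuousB.
  move=> x xI; have xab : a <= x <= b by move: xI; rewrite in_itv.
  have btw z : Num.min t (t + h) <= z <= Num.max t (t + h) -> c < z < d.
    by move: ctd cth => /= ctd cth; rewrite /Num.min /Num.max; case: ifP => _; lra.
  have [z [zI zt wE]] := mvt_between (fun z zI => dw x z xab (btw z zI)).
  have -> : h^-1 * (w x (t + h) * g x - w x t * g x) - wt x t * g x =
      (wt x z - wt x t) * g x.
    by rewrite -mulrBl wE [t + h]addrC addrK; field.
  rewrite normrM ler_pM ?gM//; apply/ltW/rP; [|exact: btw|exact: xI].
  by apply: le_lt_trans zt _; rewrite [t + h]addrC addrK.
have -> : e / (M * (b - a) + 1) * M * (b - a) =
  e * (M * (b - a)) / (M * (b - a) + 1) by lra.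
by rewrite ltr_pdivrMr// ltr_pM2l//; lra.
Qed.

End TwoVariables.

(** * Modes of a solution with zero data *)

Section Uniqueness.
Variable R : realType.
Notation mu := (@lebesgue_measure R).

Lemma Rintegral_shrink (g : R -> R) e : 0 < e ->
  {within `[- pi, pi], continuous g} ->
  exists2 d, 0 < d & forall r, 0 <= r <= pi -> pi - r < d ->
   `|\int[mu]_(x in `[- pi, pi]) g x - \int[mu]_(x in `[- r, r]) g x| <= e.
Proof.
move=> e0 cg; have [M M0 gM] := within_continuous_bounded cg.
have D0 : 0 < 2 * (M + 1) by lra.
(* The two end pieces have total length 2 (pi - r), and |g| <= M on them. *)
exists (e / (2 * (M + 1))); first by rewrite divr_gt0.
move=> r /andP[r0 rpi]; rewrite ltr_pdivlMr// => rd.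
have gi := within_continuous_integrable cg.
have sub (a b : R) : - pi <= a -> b <= pi -> mu.-integrable `[a, b] (EFin \o g).
  by move=> a1 b1; apply: integrableS gi => //; apply: subset_itv; rewrite bnd_simp.
rewrite (@Rintegral_segmentD _ (- pi) (- r))//; [|lra|lra].
rewrite (@Rintegral_segmentD _ (- r) r)//; [|lra|by apply: sub; lra].
have h1 : `|\int[mu]_(x in `[- pi, - r]) g x| <= M * (- r - - pi).
  apply: normr_Rintegral_le; [lra|by apply: sub; lra|].
  by move=> x xI; apply: gM; move: xI; rewrite !in_itv/=; lra.
have h2 : `|\int[mu]_(x in `[r, pi]) g x| <= M * (pi - r).
  apply: normr_Rintegral_le; [lra|by apply: sub; lra|].
  by move=> x xI; apply: gM; move: xI; rewrite !in_itv/=; lra.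
by move: h1 h2; rewrite !ler_norml; nra.
Qed.

Variables (T eps : R) (u : R -> R -> R) (f : R -> R).
Hypothesis T0 : 0 < T.

Let Ob (x t : R) : x \in `[- pi, pi] -> t \in `[0, T] -> Omega_bar T (x, t).
Proof. by rewrite !in_itv. Qed.

Section Projection.
Variables (ux uxx ut : R -> R -> R) (nu sg : R) (e de : R -> R).
Hypothesis eigen : eigenfun nu sg e de.
Hypothesis cu : {within Omega_bar T, continuous (fun p : R * R => u p.1 p.2)}.
Hypothesis dux : forall x t, Omega_bar T (x, t) ->
  deriv_within (@Ipi R) (fun y => u y t) x (ux x t).
Hypothesis cux : {within Omega_bar T, continuous (fun p : R * R => ux p.1 p.2)}.
Hypothesis duxx : forall x t, Omega T (x, t) ->
  deriv_within [set y | - pi < y < pi] (fun y => ux y t) x (uxx x t).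
Hypothesis dut : forall x t, Omega T (x, t) ->
  deriv_within [set s | 0 < s < T] (fun s => u x s) t (ut x t).
Hypothesis cuxx : {within Omega T, continuous (fun p : R * R => uxx p.1 p.2)}.
Hypothesis cut : {within Omega T, continuous (fun p : R * R => ut p.1 p.2)}.
Hypothesis cf : {within @Ipi R, continuous f}.
Hypothesis heat : forall x t, Omega T (x, t) ->
  ut x t - uxx x t + eps * uxx (- x) t = f x.
Hypothesis uxpi : forall t, 0 <= t <= T -> ux (- pi) t = 0 /\ ux pi t = 0.

Let ce : continuous e. Proof. by case: eigen => /is_derive_continuous. Qed.
Let cde : continuous de. Proof. by case: eigen => _ /is_derive_continuous. Qed.

Let lam := (1 - eps * sg) * nu ^+ 2.
Let a r t := \int[mu]_(x in `[- r, r]) (u x t * e x).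
Let F r := \int[mu]_(x in `[- r, r]) (f x * e x).
(** The boundary term of Green's identity; at x = -pi and x = pi it vanishes, because u_x and e'
    both do. *)
Let beta x t := ux x t * e x - u x t * de x.

Let sub_Omega r t : r < pi -> 0 < t < T -> forall x, x \in `[- r, r] -> Omega T (x, t).
Proof. by move=> rpi tT x; rewrite in_itv/= => xI; split => //=; lra. Qed.

(** Since [-r, r] is symmetric, the reflected second derivative contributes [sg] times the integral
    of the unreflected one, so Green's identity handles both; r < pi keeps u_xx and u_t continuous
    on the segment. *)
Let a_derive r t : 0 <= r < pi -> 0 < t < T ->
  is_derive t 1 (a r) ((1 - eps * sg) * (beta r t - beta (- r) t) - lam * a r t + F r).
Proof.
move=> /andP[r0 rpi] tT; have rr : - r <= r by lra.
have oc : (0 < t < T) -> 0 <= t <= T by lra.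
have subO : [set p | - r <= p.1 <= r /\ 0 < p.2 < T] `<=` Omega T.
  by move=> [x s] /= [xr sT]; split => //=; lra.
have subOb : [set p | - r <= p.1 <= r /\ 0 < p.2 < T] `<=` Omega_bar T.
  by move=> [x s] /= [xr sT]; split => /=; lra.
have cue : {within `[- r, r], continuous e} by exact: continuous_subspaceT.
have dts x s : - r <= x <= r -> 0 < s < T -> is_derive s 1 (u x) (ut x s).
  move=> xr sT; apply: deriv_within_is_derive (dut _); last by split => //=; lra.
  have := @near_in_itvoo R 0 T s; rewrite in_itv/= => /(_ sT).
  by apply: filterS => y; rewrite /= in_itv.
have da := is_derive_Rintegral_param rr tT (continuous_subspaceW subOb cu)
  (continuous_subspaceW subO cut) dts cue.
apply: (is_derive_eq da).
have cO (w : R -> R -> R) : {within Omega T, continuous (fun p : R * R => w p.1 p.2)} ->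
    {within `[- r, r], continuous (w ^~ t)}.
  by move=> cw; apply: slice_continuous cw _; exact: sub_Omega.
have cOb (w : R -> R -> R) : {within Omega_bar T, continuous (fun p : R * R => w p.1 p.2)} ->
    {within `[- r, r], continuous (w ^~ t)}.
  move=> cw; apply: slice_continuous cw _ => x; rewrite /= in_itv/= => xr.
  by split => /=; lra.
have cfr : {within `[- r, r], continuous f}.
  apply: continuous_subspaceW cf => x; rewrite /Ipi /= !in_itv/=; lra.
have cxx := cO _ cuxx.
have cxxN := within_continuous_opp cxx.
have c1 : {within `[- r, r], continuous (fun x => uxx x t * e x)}.
  exact: within_continuousM.
have c2 : {within `[- r, r], continuous (fun x => uxx (- x) t * e x)}.
  exact: within_continuousM.
have c3 : {within `[- r, r], continuous (fun x => f x * e x)}.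
  exact: within_continuousM.
have c2' : {within `[- r, r], continuous (fun x => eps * (uxx (- x) t * e x))}.
  by apply: within_continuousM => //; exact: within_continuous_cst.
have green := @green_identity R r nu sg e de (u ^~ t) (ux ^~ t) (uxx ^~ t) r0
  eigen (cOb _ cu) (cOb _ cux) cxx.
have refl : \int[mu]_(x in `[- r, r]) (uxx (- x) t * e x) =
    sg * \int[mu]_(x in `[- r, r]) (uxx x t * e x).
  have [_ _ eN _ _] := eigen.
  rewrite -(Rintegral_opp r0 c2) -Rintegral_continuousZ//.
  by apply: eq_segment_integral => x _; rewrite opprK eN mulrCA.
transitivity (\int[mu]_(x in `[- r, r]) (uxx x t * e x - eps * (uxx (- x) t * e x) + f x * e x)).
  apply: eq_segment_integral => x xI.
  by rewrite -(heat (sub_Omega rpi tT xI)); lra.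
rewrite Rintegral_continuousD//; last exact: within_continuousB.
rewrite Rintegral_continuousB// Rintegral_continuousZ// refl -/(F r).
have {}green : \int[mu]_(x in `[- r, r]) (uxx x t * e x) +
    nu ^+ 2 * a r t = beta r t - beta (- r) t.
  apply: green => x; rewrite in_itv/= => xr.
    apply: deriv_within_is_derive (dux _); last by split => /=; lra.
    by apply: Ipi_nbhs; lra.
  apply: deriv_within_is_derive (duxx _); last by split => //=; lra.
  have := @near_in_itvoo R (- pi) pi x; rewrite in_itv/=.
  have xpi : - pi < x < pi by lra.
  by move=> /(_ xpi); apply: filterS => y; rewrite /= in_itv.
by rewrite /lam -green; lra.
Qed.

Let cbeta : {within Omega_bar T, continuous (fun p : R * R => beta p.1 p.2)}.
Proof.
have c (g : R -> R) : continuous g ->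
    {within Omega_bar T, continuous (fun p : R * R => g p.1)}.
  by move=> cg; apply: continuous_subspaceT => p; apply: continuous_comp; [exact: cvg_fst|exact: cg].
by apply: within_continuousB; apply: within_continuousM => //; exact: c.
Qed.

(** [beta] is continuous on the closed rectangle and 0 on its lateral sides; compactness of [0, T]
    makes the smallness near those sides uniform in t. *)
Let beta_small eta : 0 < eta -> exists2 d, 0 < d & forall r t, 0 <= r <= pi ->
  pi - r < d -> t \in `[0, T] -> `|beta r t - beta (- r) t| <= eta.
Proof.
move=> eta0; have e20 : 0 < eta / 2 by rewrite divr_gt0.
have pi0 := @pi_ge0 R.
have [_ _ _ dl dr] := eigen.
have b0 t : t \in `[0, T] -> beta pi t = 0 /\ beta (- pi) t = 0.
  rewrite in_itv/= => /uxpi[ul ur].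
  by rewrite /beta ul ur dl dr !mul0r !mulr0 subrr.
have sw : forall (t s : R), `[0, T]%classic t -> `[- pi, pi]%classic s ->
    [set p : R * R | Omega_bar T (p.2, p.1)] (t, s).
  by move=> t s tI sI; exact: Ob.
have pI : `[- pi, pi]%classic (pi : R) by rewrite /= in_itv/=; lra.
have NpI : `[- pi, pi]%classic (- pi : R) by rewrite /= in_itv/=; lra.
have [d1 d10 d1P] := continuous_param_uniform (w := fun t x => beta x t)
  (@segment_compact R 0 T) pI e20 (swap_continuous cbeta) sw.
have [d2 d20 d2P] := continuous_param_uniform (w := fun t x => beta x t)
  (@segment_compact R 0 T) NpI e20 (swap_continuous cbeta) sw.
exists (Num.min d1 d2); first by rewrite lt_min d10.
move=> r t rpi; rewrite lt_min => /andP[r1 r2] tI.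
have [bl br] := b0 t tI.
have h1 : `|beta r t - beta pi t| < eta / 2.
  by apply: d1P => //=; [rewrite ler0_norm; lra|rewrite in_itv/=; lra].
have h2 : `|beta (- r) t - beta (- pi) t| < eta / 2.
  by apply: d2P => //=; [rewrite ger0_norm; lra|rewrite in_itv/=; lra].
move: h1 h2; rewrite bl br !subr0 !ltr_norml ler_norml; lra.
Qed.

Hypothesis u0 : forall x, @Ipi R x -> u x 0 = 0.
Hypothesis uT : forall x, @Ipi R x -> u x T = 0.

Let cue : {within Omega_bar T, continuous (fun p : R * R => u p.1 p.2 * e p.1)}.
Proof.
apply: within_continuousM => //; apply: continuous_subspaceT => p.
by apply: continuous_comp; [exact: cvg_fst|exact: ce].
Qed.

Let slice_ue t : t \in `[0, T] ->
  {within `[- pi, pi], continuous (fun x => u x t * e x)}.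
Proof.
by move=> tI; apply: (slice_continuous (w := fun x t => u x t * e x)) cue _ => x xI; exact: Ob.
Qed.

Let cfe : {within `[- pi, pi], continuous (fun x => f x * e x)}.
Proof. by apply: within_continuousM => //; exact: continuous_subspaceT. Qed.

Let cexp (k : R) : continuous (fun s : R => expR (k * s)).
Proof. by apply: continuous_mulr_comp; exact: continuous_expR. Qed.

(* Rolle's theorem and then the mean value theorem for
   [s |-> a r s * exp (lam s)], whose derivative contains only boundary terms
   and [F r]. *)
Let truncated_bound : exists2 K, 0 <= K & forall eta r, 0 <= r < pi -> 0 < eta ->
  (forall t, t \in `[0, T] -> `|beta r t - beta (- r) t| <= eta) ->
  `|F r| <= K * eta /\ forall t, t \in `[0, T] -> `|a r t| <= K * eta.
Proof.
have [E1 E10 hE1] := within_continuous_bounded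
  (continuous_subspaceT (@cexp lam) : {within `[0, T], continuous _}).
have [E2 E20 hE2] := within_continuous_bounded
  (continuous_subspaceT (@cexp (- lam)) : {within `[0, T], continuous _}).
pose C := `|1 - eps * sg|; have C0 : 0 <= C by exact: normr_ge0.
have K0 : 0 <= 2 * C * E1 * T * E2 by rewrite !mulr_ge0// ltW.
exists (C + 2 * C * E1 * T * E2); first by rewrite addr_ge0.
move=> eta r /andP[r0 rpi] eta0 bs; have pi0 := @pi_gt0 R.
pose g s := a r s * expR (lam * s).
pose b s := (1 - eps * sg) * (beta r s - beta (- r) s).
have bC s : s \in `[0, T] -> `|b s| <= C * eta.
  by move=> sI; rewrite normrM ler_wpM2l// bs.
have dg s : 0 < s < T -> is_derive s 1 g ((b s + F r) * expR (lam * s)).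
  move=> sT; have rI : 0 <= r < pi by rewrite r0.
  have d1 := a_derive rI sT.
  have d2 : is_derive s 1 (fun s => expR (lam * s)) (lam * expR (lam * s)).
    by apply: (@is_derive_comp_mul R expR expR) => y; exact: is_derive_expR.
  apply: (is_derive_eq (is_deriveM d1 d2)).
  by rewrite /GRing.scale/= /b; lra.
have cg : {within `[0, T], continuous g}.
  apply: within_continuousM; last exact: continuous_subspaceT.
  apply: (Rintegral_param_continuous (w := fun x t => u x t * e x) _ cue).
    by lra.
  by move=> x s xI sI; apply: Ob => //; move: xI; rewrite !in_itv/=; lra.
have a0 (t : R) : (forall x, @Ipi R x -> u x t = 0) -> a r t = 0.
  move=> ut0; rewrite -[RHS](mul0r (r - - r)) -Rintegral_segment_cst; last by lra.
  apply: eq_segment_integral => x xI; rewrite ut0 ?mul0r//.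
  by move: xI; rewrite /Ipi/= !in_itv/=; lra.
have g0 : g 0 = 0 by rewrite /g a0// mul0r.
have gT : g T = 0 by rewrite /g a0// mul0r.
have FC : `|F r| <= C * eta.
  have dgo s : s \in `]0, T[ -> is_derive s 1 g ((b s + F r) * expR (lam * s)).
    by rewrite in_itv/= => /dg.
  have [c cI] := MVT T0 dgo cg.
  rewrite gT g0 subrr subr0 => /esym/eqP; rewrite !mulf_eq0 (gt_eqF T0) orbF.
  rewrite (gt_eqF (expR_gt0 _)) orbF addrC addr_eq0 => /eqP ->.
  by rewrite normrN; apply: bC; exact: subset_itv_oo_cc.
split; first by apply: (le_trans FC); rewrite ler_wpM2r ?lerDl// ltW.
move=> t tI; have := tI; rewrite in_itv/= => /andP[t0 tT].
have gt : `|g t| <= 2 * C * eta * E1 * T.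
  have [||c cI] := @MVT_segment R g (fun s => (b s + F r) * expR (lam * s)) 0 t t0.
  - by move=> s; rewrite in_itv/= => /andP[s0 st]; apply: dg; rewrite s0 (lt_le_trans st).
  - by apply: continuous_subspaceW cg => s; rewrite /= !in_itv/=; lra.
  have cT : c \in `[0, T] by move: cI; rewrite !in_itv/=; lra.
  rewrite g0 !subr0 => ->; rewrite !normrM ler_pM//.
    rewrite ler_pM ?hE1//; apply: (le_trans (ler_normD _ _)).
    by have := bC c cT; lra.
  by rewrite ger0_norm.
have -> : a r t = g t * expR (- lam * t).
  by rewrite /g mulNr expRN mulfK// gt_eqF// expR_gt0.
rewrite normrM; apply: (@le_trans _ _ (2 * C * eta * E1 * T * E2)).
  by rewrite ler_pM// hE2.
have : 0 <= C * eta by rewrite mulr_ge0// ltW.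
by lra.
Qed.

(** [K] is independent of [r] and [eta]: for each [eta], a radius near pi bounds the full integral
    by (K + 1) eta, the additional [eta] being the cost of truncation. *)
Lemma projection_eq0 : \int[mu]_(x in `[- pi, pi]) (f x * e x) = 0 /\
  forall t, t \in `[0, T] -> \int[mu]_(x in `[- pi, pi]) (u x t * e x) = 0.
Proof.
have [K K0 Kb] := truncated_bound; have pi0 := @pi_gt0 R.
have lim0 (X : R) : (forall eta, 0 < eta -> `|X| <= (K + 1) * eta) -> X = 0.
  move=> XK; apply/eqP; rewrite -normr_eq0 eq_le normr_ge0 andbT.
  apply/ler_addgt0Pr => eta eta0; rewrite add0r.
  have K1 : 0 < K + 1 by lra.
  apply: (le_trans (XK (eta / (K + 1)) _)); first by rewrite divr_gt0.
  by rewrite mulrC divfK// gt_eqF.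
have step (g : R -> R) eta : 0 < eta -> {within `[- pi, pi], continuous g} ->
    (forall r, 0 <= r < pi ->
      (forall t, t \in `[0, T] -> `|beta r t - beta (- r) t| <= eta) ->
      `|\int[mu]_(x in `[- r, r]) g x| <= K * eta) ->
    `|\int[mu]_(x in `[- pi, pi]) g x| <= (K + 1) * eta.
  move=> eta0 cg gK; have [d d0 dP] := beta_small eta0.
  have [d' d'0 d'P] := Rintegral_shrink eta0 cg.
  (* Halving makes pi - r strictly smaller than both moduli; the maximum keeps r nonnegative when
     they are large. *)
  pose r := Num.max 0 (pi - Num.min d d' / 2).
  have m0 : 0 < Num.min d d' by rewrite lt_min d0.
  have rI : 0 <= r < pi by rewrite /r le_max lexx/= gt_max pi0/=; lra.
  have rI' : 0 <= r <= pi by lra.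
  have rm : pi - r < Num.min d d'.
    have : pi - Num.min d d' / 2 <= r by rewrite le_max lexx orbT.
    by lra.
  have [r1 r2] : pi - r < d /\ pi - r < d'.
    by move: rm; rewrite lt_min => /andP[].
  have h1 := gK r rI (fun t tI => dP r t rI' r1 tI).
  have h2 := d'P r rI' r2.
  rewrite -[X in `|X|](subrK (\int[mu]_(x in `[- r, r]) g x)).
  by apply: (le_trans (ler_normD _ _)); rewrite mulrDl mul1r addrC lerD.
split; first by apply: lim0 => eta eta0; apply: step => // r rI /(Kb _ _ rI eta0)[].
move=> t tI; apply: lim0 => eta eta0; apply: step => //; first exact: slice_ue.
by move=> r rI /(Kb _ _ rI eta0)[_]; exact.
Qed.

End Projection.
End Uniqueness.

(** * Uniqueness *)

Section UniqueSolution.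
Variable R : realType.
Variables (eps T : R).
Hypothesis T0 : 0 < T.

Lemma zero_data_solution u f :
  regular_solution eps T (fun=> 0) (fun=> 0) u f ->
  (forall x t, Omega_bar T (x, t) -> u x t = 0) /\
  (forall x, @Ipi R x -> f x = 0).
Proof.
move=> [ux [uxx [ut [cu [dux [cux [duxx [dut [cuxx [cut [cf [heat [u0 [uT uxpi]]]]]]]]]]]]]].
have proj nu sg e de (h : eigenfun nu sg e de) := projection_eq0 T0 h cu dux cux
  duxx dut cuxx cut cf heat uxpi u0 uT.
split; last first.
  by apply: trig_complete => // k; [case: (proj _ _ _ _ (eigenfun_cos R k))|case: (proj _ _ _ _ (eigenfun_sin R k))].
move=> x t [/= xI tI]; have tI' : t \in `[0, T] by rewrite in_itv.
apply: (trig_complete (g := u ^~ t)).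
- apply: slice_continuous cu _ => y yI; split => //.
- by move=> k; case: (proj _ _ _ _ (eigenfun_cos R k)) => _; apply.
- by move=> k; case: (proj _ _ _ _ (eigenfun_sin R k)) => _; apply.
- by rewrite in_itv.
Qed.

Lemma regular_solution_unique phi psi u f v g :
  regular_solution eps T phi psi u f -> regular_solution eps T phi psi v g ->
  (forall x t, Omega_bar T (x, t) -> u x t = v x t) /\
  (forall x, @Ipi R x -> f x = g x).
Proof.
move=> [ux [uxx [ut [cu [dux [cux [duxx [dut [cuxx [cut [cf [heat [u0 [uT uxpi]]]]]]]]]]]]]].
move=> [vx [vxx [vt [cv [dvx [cvx [dvxx [dvt [cvxx [cvt [cg [heat' [v0 [vT vxpi]]]]]]]]]]]]]].
have [|h1 h2] := @zero_data_solution (fun x t => u x t - v x t) (fun x => f x - g x).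
  exists (fun x t => ux x t - vx x t), (fun x t => uxx x t - vxx x t),
    (fun x t => ut x t - vt x t).
  do !split.
  - exact: within_continuousB.
  - by move=> x t h; apply: deriv_withinB; [exact: dux|exact: dvx].
  - exact: within_continuousB.
  - by move=> x t h; apply: deriv_withinB; [exact: duxx|exact: dvxx].
  - by move=> x t h; apply: deriv_withinB; [exact: dut|exact: dvt].
  - exact: within_continuousB.
  - exact: within_continuousB.
  - exact: within_continuousB.
  - by move=> x t h; rewrite -(heat x t h) -(heat' x t h); lra.
  - by move=> x h; rewrite u0// v0// subrr.
  - by move=> x h; rewrite uT// vT// subrr.
  - by move: H => /[dup] /uxpi[-> _] /vxpi[-> _]; rewrite subrr.
  - by move: H => /[dup] /uxpi[_ ->] /vxpi[_ ->]; rewrite subrr.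
split => [x t /h1|x /h2] /eqP; by rewrite subr_eq0 => /eqP.
Qed.

End UniqueSolution.

(** * Termwise integration and summability of coefficients *)

Section SeriesIntegral.
Variable R : realType.
Notation mu := (@lebesgue_measure R).

Lemma Rintegral_series (a b : R) (q : nat -> R -> R) n :
  (forall k, {within `[a, b], continuous (q k)}) ->
  {within `[a, b], continuous (fun x => series (q ^~ x) n)} /\
  \int[mu]_(x in `[a, b]) series (q ^~ x) n =
  series (fun k => \int[mu]_(x in `[a, b]) q k x) n.
Proof.
move=> cq; rewrite /series/=; elim: n => [|n [cs IH]].
  rewrite big_geq// (_ : (fun x => _) = fun=> 0); last first.
    by apply/funext => x; rewrite big_geq.
  split; first exact: within_continuous_cst.
  by rewrite /Rintegral integral0.
rewrite big_nat_recr//= -IH (_ : (fun x => _) =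
  fun x => \sum_(0 <= k < n) q k x + q n x); last first.
  by apply/funext => x; rewrite big_nat_recr.
split; first exact: within_continuousD.
exact: Rintegral_continuousD.
Qed.

(** The tails of [M] bound the distance from the sum to its partial sums uniformly in x. *)
Lemma Rintegral_ssum (a b : R) (q : nat -> R -> R) (M : nat -> R) : a <= b ->
  cvgn (series M) -> (forall k, {within `[a, b], continuous (q k)}) ->
  (forall x, x \in `[a, b] -> forall k, `|q k x| <= M k) ->
  \int[mu]_(x in `[a, b]) ssum (q ^~ x) =
  ssum (fun k => \int[mu]_(x in `[a, b]) q k x).
Proof.
move=> ab cM cq qM; apply/esym/cvg_lim => //; apply/cvgrPdist_lt => e e0.
have D0 : 0 < b - a + 1 by lra.
have e10 : 0 < e / (b - a + 1) by rewrite divr_gt0.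
have cs : {within `[a, b], continuous (fun x => ssum (q ^~ x))}.
  exact: (ssum_within_continuous (q := fun x k => q k x) cM).
have /cvgrPdist_lt/(_ _ e10) := cM; apply: filterS => n /ltr_normlW tail.
have [csn <-] := Rintegral_series n cq; rewrite -Rintegral_continuousB//.
apply: (@le_lt_trans _ _ (e / (b - a + 1) * (b - a))); last first.
  by rewrite mulrAC ltr_pdivrMr// ltr_pM2l//; lra.
apply: normr_Rintegral_le => //.
  by apply: within_continuous_integrable; exact: within_continuousB.
move=> x xI; apply: (le_trans (dominated_ssum_tail n (qM x xI) cM)).
exact: ltW.
Qed.

Lemma ssum_single (j : nat) (c : R) :
  ssum (fun k => (k == j)%:R * c) = c.
Proof.
apply: cvg_lim => //; apply: cvg_near_cst; near=> n.
have jn : (j < n)%N by near: n; exact: nbhs_infty_gt.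
rewrite /series/= big_mkord (bigD1 (Ordinal jn))//= eqxx mul1r big1 ?addr0//.
move=> k kj; rewrite (_ : (k : nat) == j = false) ?mul0r//.
by apply/negbTE; apply: contra kj => /eqP kj; apply/eqP/val_inj.
Unshelve. all: by end_near. Qed.

(** As 1 / nu k <= 2 / (k + 1), each term is at most d_k^2 + 4 / (k + 1)^2, by the inequality
    between arithmetic and geometric means. *)
Lemma summable_of_square_sums (d nu : nat -> R) (B : R) :
  (forall n, \sum_(k < n) d k ^+ 2 <= B) ->
  (forall k, k.+1%:R / 2 <= nu k) ->
  cvgn (series (fun k => `|d k| / nu k)).
Proof.
move=> dB nuk.
have nu0 k : 0 < nu k by apply: lt_le_trans (nuk k); rewrite divr_gt0// ltr0n.
apply: (@cvg_series_bounded_sums _ _ (B + 4 * 2)) => [k|n].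
  by rewrite divr_ge0// ltW.
apply: (@le_trans _ _ (\sum_(k < n) (d k ^+ 2 + 4 * (k.+1%:R ^+ 2)^-1))).
  apply: ler_sum => k _.
  have k0 : 0 < k.+1%:R :> R by rewrite ltr0n.
  have h : (nu k)^-1 <= 2 * k.+1%:R^-1.
    by rewrite -[2 / _]invf_div lef_pV2 ?posrE// divr_gt0.
  have i0 : 0 <= (nu k)^-1 by rewrite invr_ge0 ltW.
  rewrite -[d k ^+ 2]real_normK ?num_real// -exprVn.
  apply: (le_trans (ler_wpM2l (normr_ge0 (d k)) h)).
  move: (k.+1%:R^-1) (`|d k|) => z y.
  by have := sqr_ge0 (y - z); have := sqr_ge0 z; lra.
rewrite big_split/= -mulr_sumr; apply: lerD; first exact: dB.
by rewrite ler_pM2l//; exact: sum_inv_sqr_le.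
Qed.

End SeriesIntegral.

(** * A mode series solves the equation *)

(** The amplitude of each mode is the solution of a' = -lam a + F with a(0) = 0 and a(T) = b, for
    the constant F appearing in [mode_f]. *)
Definition mode_u (R : realType) (lam b : nat -> R) (T : R)
    (e : nat -> R -> R) (x t : R) : R :=
  ssum (fun k => b k * ((1 - expR (- lam k * t)) / (1 - expR (- lam k * T))) *
    e k x).

Definition mode_f (R : realType) (lam b : nat -> R) (T : R)
    (e : nat -> R -> R) (x : R) : R :=
  ssum (fun k => b k * (lam k / (1 - expR (- lam k * T))) * e k x).

Section SeriesSolution.
Variable R : realType.
Notation mu := (@lebesgue_measure R).
Variables (eps T sg : R) (nu b : nat -> R) (e de : nat -> R -> R).
Hypothesis T0 : 0 < T.
Hypothesis a0 : 0 < 1 - eps * sg.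
Hypothesis eigen : forall k, eigenfun (nu k) sg (e k) (de k).
Hypothesis e1 : forall k x, `|e k x| <= 1.
Hypothesis de1 : forall k x, `|de k x| <= nu k.
Hypothesis nu_ge : forall k, 2^-1 <= nu k.
Hypothesis b_summable : cvgn (series (fun k => `|b k| * nu k ^+ 2)).

Let lam k := (1 - eps * sg) * nu k ^+ 2.
Let W k t := (1 - expR (- lam k * t)) / (1 - expR (- lam k * T)).
Let W' k t := lam k * expR (- lam k * t) / (1 - expR (- lam k * T)).

Let w := mode_u lam b T e.
Let wx x t := ssum (fun k => b k * W k t * de k x).
Let wxx x t := ssum (fun k => b k * W k t * (- nu k ^+ 2 * e k x)).
Let wt x t := ssum (fun k => b k * W' k t * e k x).
Let g := mode_f lam b T e.

(** A common lower bound of the denominators: nu k >= 1/2 gives lam k >= (1 - eps sg) / 4. *)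
Let q := 1 - expR (- ((1 - eps * sg) * 4^-1) * T).
(** Since nu k >= 1/2, the numbers 1, nu k and (nu k)^2 are at most 4 (nu k)^2, and lam k = (1 - eps
    sg) (nu k)^2; so this one majorant covers [w], its derivatives and the source. *)
Let M k := (4 + (1 - eps * sg)) / q * (`|b k| * nu k ^+ 2).

Let q0 : 0 < q.
Proof. by rewrite subr_gt0 expR_lt1 mulNr oppr_lt0 !mulr_gt0// invr_gt0. Qed.

Let lam_ge k : (1 - eps * sg) * 4^-1 <= lam k.
Proof. by rewrite /lam ler_pM2l//; have := nu_ge k; nra. Qed.

Let den_ge k : q <= 1 - expR (- lam k * T).
Proof. by rewrite lerD2l lerN2 ler_expR !mulNr lerN2 ler_pM2r// lam_ge. Qed.

Let den_gt0 k : 0 < 1 - expR (- lam k * T).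
Proof. exact: lt_le_trans (den_ge k). Qed.

Let lam_gt0 k : 0 < lam k.
Proof. by apply: lt_le_trans (lam_ge k); rewrite mulr_gt0// invr_gt0. Qed.

Let expR_decay k t : 0 <= t -> 0 < expR (- lam k * t) <= 1.
Proof.
move=> t0; rewrite expR_gt0/= -expR0 ler_expR mulNr oppr_le0.
by rewrite mulr_ge0// ltW.
Qed.

Let quotient_le k y z : 0 <= y <= z -> `|y / (1 - expR (- lam k * T))| <= z / q.
Proof.
move=> /andP[y0 yz]; rewrite ger0_norm; last by rewrite divr_ge0// ltW.
apply: ler_pM => //; first by rewrite invr_ge0 ltW.
by rewrite lef_pV2 ?posrE.
Qed.

Let W_le k t : 0 <= t -> `|W k t| <= 1 / q.
Proof. by move=> /(expR_decay k) h; apply: quotient_le; lra. Qed.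

Let W'_le k t : 0 <= t -> `|W' k t| <= lam k / q.
Proof.
move=> /(expR_decay k)/andP[h1 h2]; apply: quotient_le.
apply/andP; split; first by rewrite mulr_ge0// ltW.
by rewrite ler_piMr// ltW.
Qed.

Let M_cvg : cvgn (series M).
Proof. exact: cvg_seriesZ. Qed.

Let term_le k y z c d : `|y| <= c / q -> `|z| <= d -> 0 <= c -> 0 <= d ->
  c * d <= (4 + (1 - eps * sg)) * nu k ^+ 2 -> `|b k * y * z| <= M k.
Proof.
move=> yc zd c0 d0 cd; rewrite !normrM /M.
have -> : (4 + (1 - eps * sg)) / q * (`|b k| * nu k ^+ 2) =
    `|b k| * ((4 + (1 - eps * sg)) * nu k ^+ 2 / q) by lra.
rewrite -mulrA ler_wpM2l//.
apply: (@le_trans _ _ (c / q * d)); first by rewrite ler_pM.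
by rewrite mulrAC ler_pM2r ?invr_gt0.
Qed.

Let nu2_ge k : 1 <= 4 * nu k ^+ 2 /\ nu k <= 4 * nu k ^+ 2.
Proof. by have := nu_ge k; split; nra. Qed.

Let An2 k : 0 <= (1 - eps * sg) * nu k ^+ 2.
Proof. by rewrite mulr_ge0 ?sqr_ge0// ltW. Qed.

Let w_le k x t : 0 <= t -> `|b k * W k t * e k x| <= M k.
Proof.
move=> t0; apply: (term_le (W_le k t0) (e1 k x)) => //.
by have [h1 h2] := nu2_ge k; have := An2 k; lra.
Qed.

Let wx_le k x t : 0 <= t -> `|b k * W k t * de k x| <= M k.
Proof.
move=> t0; have [h1 h2] := nu2_ge k; have nuk := nu_ge k.
by apply: (term_le (W_le k t0) (de1 k x)) => //; have := An2 k; lra.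
Qed.

Let wxx_le k x t : 0 <= t -> `|b k * W k t * (- nu k ^+ 2 * e k x)| <= M k.
Proof.
move=> t0; have n2 := sqr_ge0 (nu k).
apply: (@term_le k _ _ 1 (nu k ^+ 2) (W_le k t0)) => //; last by have := An2 k; lra.
have -> : `|- nu k ^+ 2 * e k x| = nu k ^+ 2 * `|e k x|.
  by rewrite normrM normrN (ger0_norm n2).
by rewrite ler_piMr.
Qed.

Let wt_le k x t : 0 <= t -> `|b k * W' k t * e k x| <= M k.
Proof.
move=> t0; have n2 := sqr_ge0 (nu k).
apply: (term_le (W'_le k t0) (e1 k x)) => //; first exact: ltW.
by rewrite /lam; nra.
Qed.

Let g_le k x : `|b k * (lam k / (1 - expR (- lam k * T))) * e k x| <= M k.
Proof.
have n2 := sqr_ge0 (nu k).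
have h : `|lam k / (1 - expR (- lam k * T))| <= lam k / q.
  by apply: quotient_le; rewrite lexx ltW.
apply: (term_le h (e1 k x)) => //; first exact: ltW.
by rewrite /lam; nra.
Qed.

Let is_derive_W k (t : R) : is_derive t 1 (W k) (W' k t).
Proof.
have d1 := @is_derive_comp_mul R expR expR (- lam k) t
  (fun y => is_derive_expR y).
have d2 := is_deriveB (is_derive_cst (1 : R) t 1) d1.
have := is_derive_mulc ((1 - expR (- lam k * T))^-1) d2.
rewrite (_ : (fun y => _) = W k); last by apply/funext => y; rewrite /W mulrC.
by move=> d3; apply: (is_derive_eq d3); rewrite /W'; lra.
Qed.

Let cW k : continuous (W k).
Proof. by apply: is_derive_continuous => t; exact: is_derive_W. Qed.

Let cW' k : continuous (W' k).
Proof.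
move=> t; apply: cvgM; last exact: cvg_cst.
apply: cvgM; first exact: cvg_cst.
by apply: (@continuous_mulr_comp R expR); exact: continuous_expR.
Qed.

Let c2 (A : set (R * R)) (c : R) (f h : R -> R) : continuous f -> continuous h ->
  {within A, continuous (fun p : R * R => c * f p.2 * h p.1)}.
Proof.
move=> cf ch; apply: continuous_subspaceT => p; apply: cvgM.
  apply: cvgM; first exact: cvg_cst.
  by apply: continuous_comp; [exact: cvg_snd|exact: cf].
by apply: continuous_comp; [exact: cvg_fst|exact: ch].
Qed.

Let ce k : continuous (e k).
Proof. by have [/is_derive_continuous] := eigen k. Qed.

Let cde k : continuous (de k).
Proof. by have [_ /is_derive_continuous] := eigen k. Qed.

Let ce2 k : continuous (fun x => - nu k ^+ 2 * e k x).
Proof. by move=> x; apply: cvgM; [exact: cvg_cst|exact: ce]. Qed.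

Let sum_continuous (V f : nat -> R -> R) :
  (forall k, continuous (V k)) -> (forall k, continuous (f k)) ->
  (forall k x t, 0 <= t -> `|b k * V k t * f k x| <= M k) ->
  {within Omega_bar T,
    continuous (fun p : R * R => ssum (fun k => b k * V k p.2 * f k p.1))}.
Proof.
move=> cV cf VM; apply: (ssum_within_continuous
    (q := fun (p : R * R) k => b k * V k p.2 * f k p.1) M_cvg).
  by move=> [x t] [/= _ /andP[t0 _]] k; exact: VM.
by move=> k; exact: c2.
Qed.

Let mode_series_continuous :
  [/\ {within Omega_bar T, continuous (fun p : R * R => w p.1 p.2)},
      {within Omega_bar T, continuous (fun p : R * R => wx p.1 p.2)},
      {within Omega_bar T, continuous (fun p : R * R => wxx p.1 p.2)},
      {within Omega_bar T, continuous (fun p : R * R => wt p.1 p.2)} &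
      {within @Ipi R, continuous g}].
Proof.
split.
- by apply: (@sum_continuous W e) => // k x t; exact: w_le.
- by apply: sum_continuous => // k x t; exact: wx_le.
- by apply: (@sum_continuous W (fun k x => - nu k ^+ 2 * e k x)) => // k x t; exact: wxx_le.
- by apply: sum_continuous => // k x t; exact: wt_le.
- apply: (ssum_within_continuous (q := fun x k =>
    b k * (lam k / (1 - expR (- lam k * T))) * e k x) M_cvg).
    by move=> x _ k; exact: g_le.
  move=> k; apply: continuous_subspaceT => x.
  by apply: cvgM; [exact: cvg_cst|exact: ce].
Qed.

Let mode_series_derive x t : Omega_bar T (x, t) ->
  deriv_within (@Ipi R) (w ^~ t) x (wx x t) /\
  deriv_within (@Ipi R) (wx ^~ t) x (wxx x t).
Proof.
move=> [/= xI /andP[t0 tT]]; have iI : is_interval (@Ipi R) := @interval_is_interval _ _.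
have xI' : (@Ipi R) x by rewrite /Ipi/= in_itv.
split.
  refine (@ssum_deriv_within R (@Ipi R) (fun k y => b k * W k t * e k y)
    (fun k y => b k * W k t * de k y) M M x iI xI' M_cvg M_cvg _ _ _) => k y.
  - by apply: is_derive_mulc; have [] := eigen k.
  - by move=> _; exact: w_le.
  - by move=> _; exact: wx_le.
refine (@ssum_deriv_within R (@Ipi R) (fun k y => b k * W k t * de k y)
  (fun k y => b k * W k t * (- nu k ^+ 2 * e k y)) M M x iI xI' M_cvg M_cvg _ _ _) => k y.
- by apply: is_derive_mulc; have [] := eigen k.
- by move=> _; exact: wx_le.
- by move=> _; exact: wxx_le.
Qed.

Let mode_series_derive_time x t : Omega T (x, t) ->
  deriv_within [set s | 0 < s < T] (w x) t (wt x t).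
Proof.
move=> [/= xI tI].
have iJ : is_interval [set s : R | 0 < s < T] by move=> y z /= y1 z1 s; lra.
refine (@ssum_deriv_within R [set s | 0 < s < T]
  (fun k s => b k * W k s * e k x) (fun k s => b k * W' k s * e k x) M M
  t iJ tI M_cvg M_cvg _ _ _) => k s.
- rewrite (_ : (fun s => b k * W k s * e k x) = (fun s => b k * e k x * W k s)).
    by rewrite [X in is_derive _ _ _ X]mulrAC; exact: is_derive_mulc.
  by apply/funext => y; rewrite mulrAC.
- by move=> /= /andP[/ltW s0 _]; exact: w_le.
- by move=> /= /andP[/ltW s0 _]; exact: wt_le.
Qed.

Let mode_series_heat x t : Omega T (x, t) ->
  wt x t - wxx x t + eps * wxx (- x) t = g x.
Proof.
move=> [/= xI /andP[/ltW t0 _]].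
have cv (f : nat -> R) : (forall k, `|f k| <= M k) -> cvgn (series f).
  by move=> fM; exact: dominated_cvg_series M_cvg.
have -> : wxx (- x) t = sg * wxx x t.
  rewrite -ssumZ; last by apply: cv => k; exact: wxx_le.
  congr ssum; apply/funext => k; have [_ _ -> _ _] := eigen k; lra.
have -> : wt x t - wxx x t + eps * (sg * wxx x t) =
    wt x t + (eps * sg - 1) * wxx x t by lra.
rewrite -ssumZ; last by apply: cv => k; exact: wxx_le.
rewrite -ssumD; last 2 first.
- by apply: cv => k; exact: wt_le.
- by apply: cvg_seriesZ; apply: cv => k; exact: wxx_le.
(* Termwise: W' k t + lam k W k t = lam k / (1 - exp(-lam k T)). *)
congr ssum; apply/funext => k; rewrite /W /W' /lam; lra.
Qed.

Let mode_series_boundary t : wx (- pi) t = 0 /\ wx pi t = 0.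
Proof.
by split; rewrite -[RHS](ssum0 R); congr ssum; apply/funext => k;
  have [_ _ _ dl dr] := eigen k; rewrite ?dl ?dr mulr0.
Qed.

Lemma mode_series_solution : exists wx wxx wt : R -> R -> R,
  [/\ {within Omega_bar T, continuous (fun p : R * R => w p.1 p.2)},
      {within Omega_bar T, continuous (fun p : R * R => wx p.1 p.2)},
      {within Omega_bar T, continuous (fun p : R * R => wxx p.1 p.2)},
      {within Omega_bar T, continuous (fun p : R * R => wt p.1 p.2)} &
      {within @Ipi R, continuous g}] /\
  [/\ forall x t, Omega_bar T (x, t) ->
        deriv_within (@Ipi R) (w ^~ t) x (wx x t) /\
        deriv_within (@Ipi R) (wx ^~ t) x (wxx x t),
      forall x t, Omega T (x, t) ->
        deriv_within [set s | 0 < s < T] (w x) t (wt x t),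
      forall x t, Omega T (x, t) ->
        wt x t - wxx x t + eps * wxx (- x) t = g x &
      forall t, wx (- pi) t = 0 /\ wx pi t = 0].
Proof.
exists wx, wxx, wt; split; first exact: mode_series_continuous.
split; [exact: mode_series_derive|exact: mode_series_derive_time|
  exact: mode_series_heat|exact: mode_series_boundary].
Qed.

Lemma mode_series_init x : w x 0 = 0.
Proof.
rewrite -[RHS](ssum0 R); congr ssum; apply/funext => k.
by rewrite /W mulr0 expR0 subrr mul0r mulr0 mul0r.
Qed.

Lemma mode_series_cvg x t : 0 <= t ->
  cvgn (series (fun k => b k * W k t * e k x)).
Proof. by move=> t0; apply: dominated_cvg_series M_cvg => k; exact: w_le. Qed.

Lemma source_series_cvg x :
  cvgn (series (fun k => b k * (lam k / (1 - expR (- lam k * T))) * e k x)).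
Proof. by apply: dominated_cvg_series M_cvg => k; exact: g_le. Qed.

(** All weights equal 1 at t = T, so only the coefficients [b] remain, and |h| <= 1 preserves the
    majorant. Taking eigenfunctions for [h] tests the final condition. *)
Lemma mode_series_final_integral (h : R -> R) : continuous h ->
  (forall x, `|h x| <= 1) ->
  \int[mu]_(x in `[- pi, pi]) (w x T * h x) =
  ssum (fun k => b k * \int[mu]_(x in `[- pi, pi]) (e k x * h x)).
Proof.
move=> ch h1; have pipi : - pi <= pi :> R by have := @pi_ge0 R; lra.
have cek k : {within `[- pi, pi], continuous (fun x => e k x * h x)}.
  by apply: within_continuousM; exact: continuous_subspaceT.
have eM k x : `|b k * W k T * e k x| <= M k by apply: w_le; exact: ltW.
have bW k : b k * W k T = b k by rewrite /W divff ?mulr1// gt_eqF.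
transitivity (\int[mu]_(x in `[- pi, pi]) ssum (fun k => b k * (e k x * h x))).
  apply: eq_segment_integral => x _; rewrite mulrC -ssumZ.
    by congr ssum; apply/funext => k; rewrite bW mulrC mulrA.
  by apply: dominated_cvg_series M_cvg => k.
rewrite (@Rintegral_ssum R _ _ (fun k x => b k * (e k x * h x)) M)//.
- by congr ssum; apply/funext => k; exact: Rintegral_continuousZ.
- move=> k; apply: within_continuousM => //; exact: within_continuous_cst.
- move=> x _ k; rewrite mulrA normrM -(bW k).
  by apply: (le_trans (ler_piMr _ (h1 x))).
Qed.

End SeriesSolution.

(** * From limits of series to the stated formulas *)

Section SeriesTo.
Variable R : realType.
Implicit Types A B : nat -> R.

Lemma series_to0 c A B : (forall k, c * A k = B k) ->
  cvgn (series A) -> series_to 0 B (c * ssum A).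
Proof.
move=> AB cA; rewrite -ssumZ// (_ : B = fun k => c * A k).
  by have h : cvgn (series (fun k => c * A k)) by exact: cvg_seriesZ.
by apply/funext => k; rewrite AB.
Qed.

(** Absorbs the shift of the cosine modes, whose index k stands for frequency k + 1. The factor [c]
    is a sign in every use. *)
Lemma series_to1 c A B : (forall k, c * A k = B k.+1) ->
  cvgn (series A) -> series_to 1 B (c * ssum A).
Proof.
move=> AB cA; rewrite /series_to -(cvg_shiftS _ _).
under eq_fun do rewrite big_add1 /=.
exact: (@series_to0 c A (fun k => B k.+1)).
Qed.

End SeriesTo.

Section Terms.
Variable F : fieldType.

Lemma solution_term (x y z c h : F) : c / z * (x / y) * h = x * c / (y * z) * h.
Proof. by rewrite invfM; ring. Qed.

Lemma source_term (a L p q z E h : F) : z != 0 -> L = a * z ^+ 2 ->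
  - ((q - p) / z ^+ 3) * (L / E) * h = a * (p - q) / (z * E) * h.
Proof.
by move=> z0 ->; rewrite (invfM z E); move: E^-1 => w; field.
Qed.

End Terms.

(** * Existence: the explicit solution for the given data *)

Section Assembly.
Variable R : realType.
Notation mu := (@lebesgue_measure R).
Variables (T eps : R) (phi phi1 phi2 phi3 psi psi1 psi2 psi3 : R -> R).
Hypotheses (T0 : 0 < T) (eps1 : `|eps| < 1).
Hypotheses (dphi : C2_H3_data phi phi1 phi2 phi3)
  (dpsi : C2_H3_data psi psi1 psi2 psi3).
Hypotheses (phil : phi1 (- pi) = 0) (phir : phi1 pi = 0)
  (psil : psi1 (- pi) = 0) (psir : psi1 pi = 0).

(* The cosine modes are shifted: mode [k] has frequency [k.+1]. *)
Let nuc (k : nat) : R := k.+1%:R.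
Let nus (k : nat) : R := k%:R + 2^-1.
Let ec (k : nat) (x : R) : R := cos (k.+1%:R * x).
Let dec (k : nat) (x : R) : R := - k.+1%:R * sin (k.+1%:R * x).
Let es (k : nat) (x : R) : R := sin ((k%:R + 2^-1) * x).
Let des (k : nat) (x : R) : R := (k%:R + 2^-1) * cos ((k%:R + 2^-1) * x).
Let bc (k : nat) : R := (fcoef2 psi3 k.+1 - fcoef2 phi3 k.+1) / k.+1%:R ^+ 3.
(** The sign comes from the integrations by parts: they give a minus for sines and a plus for
    cosines, see [sin_coef] and [cos_coef]. *)
Let bs (k : nat) : R :=
  - ((fcoef1 psi3 k - fcoef1 phi3 k) / (k%:R + 2^-1) ^+ 3).

Let eigc k : eigenfun (nuc k) 1 (ec k) (dec k). Proof. exact: eigenfun_cos. Qed.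
Let eigs k : eigenfun (nus k) (- 1) (es k) (des k). Proof. exact: eigenfun_sin. Qed.

Let nuc_ge k : k.+1%:R / 2 <= nuc k.
Proof. by rewrite /nuc ler_pdivrMr// ler_peMr// ler1n. Qed.

Let nus_ge k : k.+1%:R / 2 <= nus k.
Proof.
rewrite /nus -[k.+1%:R]natr1; have : 0 <= k%:R :> R by []; move: (k%:R : R) => z.
lra.
Qed.

Let half_le k : 2^-1 <= k.+1%:R / 2 :> R.
Proof. by rewrite -[X in X <= _]mul1r ler_pM2r ?invr_gt0// ler1n. Qed.

Let nuc_half k : 2^-1 <= nuc k. Proof. exact: le_trans (half_le k) (nuc_ge k). Qed.
Let nus_half k : 2^-1 <= nus k. Proof. exact: le_trans (half_le k) (nus_ge k). Qed.

Let ec1 k x : `|ec k x| <= 1. Proof. by rewrite ler_norml cos_geN1 cos_le1. Qed.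
Let es1 k x : `|es k x| <= 1. Proof. by rewrite ler_norml sin_geN1 sin_le1. Qed.

Let dec1 k x : `|dec k x| <= nuc k.
Proof.
by rewrite /dec normrM normrN normr_nat ler_piMr// ler_norml sin_geN1 sin_le1.
Qed.

Let des1 k x : `|des k x| <= nus k.
Proof.
rewrite /des normrM ger0_norm; last by rewrite addr_ge0// invr_ge0.
by rewrite ler_piMr ?addr_ge0 ?invr_ge0// ler_norml cos_geN1 cos_le1.
Qed.

Let a_cos : 0 < 1 - eps * 1. Proof. by move: eps1; rewrite ltr_norml; lra. Qed.
Let a_sin : 0 < 1 - eps * (- 1). Proof. by move: eps1; rewrite ltr_norml; lra. Qed.

(** Bessel's inequality is applied to the derivatives of the eigenfunctions up to a factor; these
    are again orthogonal, with square norm pi. *)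
Lemma fcoef2_summable (h h1 h2 h3 : R -> R) : C2_H3_data h h1 h2 h3 ->
  cvgn (series (fun k => `|fcoef2 h3 k.+1| / nuc k)).
Proof.
move=> [_ [_ [_ [mh [ih _]]]]].
have [i1 i2] := sqr_integrable_integrable mh ih.
apply: summable_of_square_sums nuc_ge => n.
apply: (bessel (@pi_gt0 R) i1 i2 (s := fun k x => sin (k.+1%:R * x))).
  by move=> k; apply: continuous_subspaceT; exact: continuous_sin_mul.
exact: sin_orthogonal.
Qed.

Lemma fcoef1_summable (h h1 h2 h3 : R -> R) : C2_H3_data h h1 h2 h3 ->
  cvgn (series (fun k => `|fcoef1 h3 k| / nus k)).
Proof.
move=> [_ [_ [_ [mh [ih _]]]]].
have [i1 i2] := sqr_integrable_integrable mh ih.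
apply: summable_of_square_sums nus_ge => n.
apply: (bessel (@pi_gt0 R) i1 i2 (s := fun k x => cos ((k%:R + 2^-1) * x))).
  by move=> k; apply: continuous_subspaceT; exact: continuous_cos_mul.
exact: cos_half_orthogonal.
Qed.

Let summable_sub (p q nu : nat -> R) : (forall k, 2^-1 <= nu k) ->
  cvgn (series (fun k => `|p k| / nu k)) ->
  cvgn (series (fun k => `|q k| / nu k)) ->
  cvgn (series (fun k => `|(q k - p k) / nu k ^+ 3| * nu k ^+ 2)).
Proof.
move=> nuh cp cq; apply: (dominated_cvg_series _ (is_cvg_seriesD cp cq)) => k /=.
have nu0 : 0 < nu k by apply: lt_le_trans (nuh k); rewrite invr_gt0.
rewrite normrM normr_id (ger0_norm (sqr_ge0 (nu k))) normrM normfV.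
rewrite [`|nu k ^+ 3|]ger0_norm ?exprn_ge0 ?(ltW nu0)//.
rewrite -[X in _ <= X]mulrDl (_ : (nu k ^+ 3)^-1 = (nu k)^-1 * (nu k ^+ 2)^-1); last first.
  by rewrite -invfM -exprS.
rewrite -!mulrA mulVf ?expf_neq0 ?gt_eqF// mulr1 ler_pM2r ?invr_gt0//.
by rewrite [X in _ <= X]addrC; exact: ler_normB.
Qed.

Let bc_summable : cvgn (series (fun k => `|bc k| * nuc k ^+ 2)).
Proof. by apply: summable_sub (fcoef2_summable dphi) (fcoef2_summable dpsi). Qed.

Let bs_summable : cvgn (series (fun k => `|bs k| * nus k ^+ 2)).
Proof.
rewrite (_ : (fun k => _) = (fun k => `|(fcoef1 psi3 k - fcoef1 phi3 k) / nus k ^+ 3| * nus k ^+ 2)).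
  by apply: summable_sub (fcoef1_summable dphi) (fcoef1_summable dpsi).
by apply/funext => k; rewrite normrN.
Qed.

Let cos_coef (h h1 h2 h3 : R -> R) k : C2_H3_data h h1 h2 h3 ->
  h1 (- pi) = 0 -> h1 pi = 0 ->
  \int[mu]_(x in `[- pi, pi]) (h x * cos (k.+1%:R * x)) =
  pi * (fcoef2 h3 k.+1 / k.+1%:R ^+ 3).
Proof.
move=> dh hl hr; have n0 : k.+1%:R != 0 :> R by rewrite pnatr_eq0.
have [_ [_ [_ [mh [ih _]]]]] := dh; have [i1 _] := sqr_integrable_integrable mh ih.
rewrite (C2_H3_coef n0 (eigc k) dh hl hr) /dec /fcoef2 /Ipi.
have -> : \int[mu]_(x in `[- pi, pi]) (h3 x * (- k.+1%:R * sin (k.+1%:R * x))) =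
    - k.+1%:R * \int[mu]_(x in `[- pi, pi]) (h3 x * sin (k.+1%:R * x)).
  rewrite -RintegralZl//; first by apply: eq_segment_integral => x _; rewrite mulrCA.
  apply: integrable_mul_continuous => //; apply: continuous_subspaceT.
  exact: continuous_sin_mul.
have pi0 : pi != 0 :> R by rewrite gt_eqF ?pi_gt0.
set I := \int[mu]_(x in _) _; move: I n0 pi0.
by move: (k.+1%:R : R) (pi : R) => n p I n0 p0; field; rewrite n0.
Qed.

Let sin_coef (h h1 h2 h3 : R -> R) k : C2_H3_data h h1 h2 h3 ->
  h1 (- pi) = 0 -> h1 pi = 0 ->
  \int[mu]_(x in `[- pi, pi]) (h x * sin ((k%:R + 2^-1) * x)) =
  - (pi * (fcoef1 h3 k / (k%:R + 2^-1) ^+ 3)).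
Proof.
move=> dh hl hr; have n0 : k%:R + 2^-1 != 0 :> R.
  by rewrite gt_eqF// ltr_wpDl// invr_gt0.
have [_ [_ [_ [mh [ih _]]]]] := dh; have [i1 _] := sqr_integrable_integrable mh ih.
rewrite (C2_H3_coef n0 (eigs k) dh hl hr) /des /fcoef1 /Ipi.
have -> : \int[mu]_(x in `[- pi, pi]) (h3 x * ((k%:R + 2^-1) * cos ((k%:R + 2^-1) * x))) =
    (k%:R + 2^-1) * \int[mu]_(x in `[- pi, pi]) (h3 x * cos ((k%:R + 2^-1) * x)).
  rewrite -RintegralZl//; first by apply: eq_segment_integral => x _; rewrite mulrCA.
  apply: integrable_mul_continuous => //; apply: continuous_subspaceT.
  exact: continuous_cos_mul.
have pi0 : pi != 0 :> R by rewrite gt_eqF ?pi_gt0.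
set I := \int[mu]_(x in _) _; move: I n0 pi0.
by move: (k%:R + 2^-1 : R) (pi : R) => n p I n0 p0; field; rewrite n0.
Qed.

Let lamc k := (1 - eps * 1) * nuc k ^+ 2.
Let lams k := (1 - eps * (- 1)) * nus k ^+ 2.
Let w1 := mode_u lamc bc T ec.
Let w2 := mode_u lams bs T es.
Let f1 := mode_f lamc bc T ec.
Let f2 := mode_f lams bs T es.
(** The constant mode has decay rate 0: its amplitude is linear in t, and its source is the
    slope. *)
Let m := (mean0 psi - mean0 phi) / T.
Let U (x t : R) := phi x + t * m + w1 x t + w2 x t.
Let F (x : R) := - phi2 x + eps * phi2 (- x) + m + f1 x + f2 x.

Let lift_continuous (A : set (R * R)) (D : set R) (h : R -> R) :
  {within D, continuous h} -> (forall x t, A (x, t) -> D x) ->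
  {within A, continuous (fun p : R * R => h p.1)}.
Proof.
move=> /within_continuous1P ch AD.
apply/(within_continuous2P _ (fun x _ => h x)) => x t /AD Dx e e0.
have [d d0 dP] := ch x Dx e e0; exists d => // x' t' xx' _ /AD.
exact: dP.
Qed.

Let time_continuous (A : set (R * R)) :
  {within A, continuous (fun p : R * R => p.2 * m)}.
Proof.
by apply: continuous_subspaceT => p; apply: cvgM; [exact: cvg_snd|exact: cvg_cst].
Qed.

Let pipi : - pi <= pi :> R. Proof. by have := @pi_ge0 R; lra. Qed.

Let w1_continuous : {within `[- pi, pi], continuous (w1 ^~ T)}.
Proof.
have [wx [wxx [wt [[cw _ _ _ _] _]]]] := mode_series_solution T0 a_cos eigc ec1 dec1 nuc_half bc_summable.
by apply: (slice_continuous cw) => x xI; split => //=; rewrite lexx ltW.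
Qed.

Let w2_continuous : {within `[- pi, pi], continuous (w2 ^~ T)}.
Proof.
have [wx [wxx [wt [[cw _ _ _ _] _]]]] := mode_series_solution T0 a_sin eigs es1 des1 nus_half bs_summable.
by apply: (slice_continuous cw) => x xI; split => //=; rewrite lexx ltW.
Qed.

(** psi minus the candidate at t = T. It is continuous, and once all its coefficients vanish
    [trig_complete] gives the final condition, in place of a separate theorem on the convergence of
    the expansion of psi - phi. *)
Let defect x := psi x - phi x - T * m - w1 x T - w2 x T.

Let defect_integral (h : R -> R) : continuous h ->
  \int[mu]_(x in `[- pi, pi]) (defect x * h x) =
  \int[mu]_(x in `[- pi, pi]) (psi x * h x) -
  \int[mu]_(x in `[- pi, pi]) (phi x * h x) -
  T * m * \int[mu]_(x in `[- pi, pi]) h x -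
  \int[mu]_(x in `[- pi, pi]) (w1 x T * h x) -
  \int[mu]_(x in `[- pi, pi]) (w2 x T * h x).
Proof.
move=> ch; have chI : {within `[- pi, pi], continuous h} by exact: continuous_subspaceT.
have [cphi _ _] := C2_H3_continuous dphi; have [cpsi _ _] := C2_H3_continuous dpsi.
have c1 : {within `[- pi, pi], continuous (fun x => psi x * h x)} by exact: within_continuousM.
have c2 : {within `[- pi, pi], continuous (fun x => phi x * h x)} by exact: within_continuousM.
have c3 : {within `[- pi, pi], continuous (fun x => T * m * h x)}.
  by apply: within_continuousM => //; exact: within_continuous_cst.
have c4 : {within `[- pi, pi], continuous (fun x => w1 x T * h x)} by exact: within_continuousM.
have c5 : {within `[- pi, pi], continuous (fun x => w2 x T * h x)} by exact: within_continuousM.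
have c12 := within_continuousB c1 c2; have c123 := within_continuousB c12 c3.
have c1234 := within_continuousB c123 c4.
rewrite -Rintegral_continuousZ// -!Rintegral_continuousB//.
by apply: eq_segment_integral => x _; rewrite /defect; lra.
Qed.

Let defect_cos (j : nat) :
  \int[mu]_(x in `[- pi, pi]) (defect x * cos (j%:R * x)) = 0.
Proof.
have pi0 := @pi_gt0 R; have pin0 : pi != 0 :> R by rewrite gt_eqF.
rewrite defect_integral; last exact: continuous_cos_mul.
have cos1 k (x : R) : `|cos (k * x)| <= 1 by rewrite ler_norml cos_geN1 cos_le1.
rewrite (mode_series_final_integral T0 a_cos eigc ec1 nuc_half bc_summable); last 2 first.
- exact: continuous_cos_mul.
- by move=> x; exact: cos1.
rewrite (mode_series_final_integral T0 a_sin eigs es1 nus_half bs_summable); last 2 first.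
- exact: continuous_cos_mul.
- by move=> x; exact: cos1.
have -> : (fun k => bs k * \int[mu]_(x in `[- pi, pi]) (es k x * cos (j%:R * x))) = fun=> 0.
  by apply/funext => k; rewrite Rintegral_sin_cos mulr0.
rewrite ssum0 subr0.
have -> : \int[mu]_(x in `[- pi, pi]) cos (j%:R * x) = (j == 0)%:R * (2 * pi).
  exact: (Rintegral_cos_int R j).
(* Frequency 0 sees only the means, which T m cancels; frequency j + 1 sees only term j of the
   cosine series. *)
case: j => [|j].
  have -> : (fun k => bc k * \int[mu]_(x in `[- pi, pi]) (ec k x * cos (0%:R * x))) = fun=> 0.
    by apply/funext => k; rewrite (cos_orthogonal R k.+1 0) addn0 !mulr0n addr0 mul0r mulr0.
  have -> : T * m = mean0 psi - mean0 phi by rewrite /m mulrC divfK ?gt_eqF.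
  rewrite ssum0 subr0 /mean0 /Ipi.
  have e0 (h : R -> R) : \int[mu]_(x in `[- pi, pi]) (h x * cos (0%:R * x)) =
      \int[mu]_(x in `[- pi, pi]) h x.
    by apply: eq_segment_integral => x _; rewrite mul0r cos0 mulr1.
  rewrite !e0; set I := \int[mu]_(x in _) _; set J := \int[mu]_(x in _) _.
  by rewrite mul1r; move: I J pin0; move: (pi : R) => p I J p0; field.
rewrite (cos_coef j dphi phil phir) (cos_coef j dpsi psil psir) mul0r mulr0 subr0.
have -> : (fun k => bc k * \int[mu]_(x in `[- pi, pi]) (ec k x * cos (j.+1%:R * x))) =
    fun k => (k == j)%:R * (bc j * pi).
  apply/funext => k; rewrite (cos_orthogonal R k.+1 j.+1) eqSS addr0.
  by case: eqVneq => [->|_]; rewrite ?mul1r ?mul0r ?mulr0.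
by rewrite ssum_single /bc; move: (j.+1%:R ^+ 3)^-1 => z; lra.
Qed.

Let defect_sin (j : nat) :
  \int[mu]_(x in `[- pi, pi]) (defect x * sin ((j%:R + 2^-1) * x)) = 0.
Proof.
rewrite defect_integral; last exact: continuous_sin_mul.
have sin1 k (x : R) : `|sin (k * x)| <= 1 by rewrite ler_norml sin_geN1 sin_le1.
rewrite (mode_series_final_integral T0 a_cos eigc ec1 nuc_half bc_summable); last 2 first.
- exact: continuous_sin_mul.
- by move=> x; exact: sin1.
rewrite (mode_series_final_integral T0 a_sin eigs es1 nus_half bs_summable); last 2 first.
- exact: continuous_sin_mul.
- by move=> x; exact: sin1.
have -> : (fun k => bc k * \int[mu]_(x in `[- pi, pi]) (ec k x * sin ((j%:R + 2^-1) * x))) = fun=> 0.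
  apply/funext => k; under eq_segment_integral => x _ do rewrite mulrC.
  by rewrite Rintegral_sin_cos mulr0.
have -> : \int[mu]_(x in `[- pi, pi]) sin ((j%:R + 2^-1) * x) = 0.
  rewrite -[RHS](@Rintegral_sin_cos R (j%:R + 2^-1) 0).
  by apply: eq_segment_integral => x _; rewrite mul0r cos0 mulr1.
have -> : (fun k => bs k * \int[mu]_(x in `[- pi, pi]) (es k x * sin ((j%:R + 2^-1) * x))) =
    fun k => (k == j)%:R * (bs j * pi).
  apply/funext => k; rewrite sin_half_orthogonal.
  by case: eqVneq => [->|_]; rewrite ?mul1r ?mul0r ?mulr0.
rewrite ssum0 ssum_single (sin_coef j dphi phil phir) (sin_coef j dpsi psil psir) /bs.
by lra.
Qed.

Let final_condition x : (@Ipi R) x -> U x T = psi x.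
Proof.
move=> xI; have [cphi _ _] := C2_H3_continuous dphi.
have [cpsi _ _] := C2_H3_continuous dpsi.
have cd : {within `[- pi, pi], continuous defect}.
  do 3 (apply: within_continuousB => //); first exact: within_continuousB.
  exact: within_continuous_cst.
by have := trig_complete cd defect_cos defect_sin xI; rewrite /defect /U; lra.
Qed.

Lemma series_regular_solution : regular_solution eps T phi psi U F.
Proof.
have [v1x [v1xx [v1t [[c1 c1x c1xx c1t cf1] [d1 d1t h1 b1]]]]] :=
  mode_series_solution T0 a_cos eigc ec1 dec1 nuc_half bc_summable.
have [v2x [v2xx [v2t [[c2 c2x c2xx c2t cf2] [d2 d2t h2 b2]]]]] :=
  mode_series_solution T0 a_sin eigs es1 des1 nus_half bs_summable.
have [cphi cphi1 cphi2] := C2_H3_continuous dphi; have [dp1 [dp2 _]] := dphi.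
have ObI x t : Omega_bar T (x, t) -> (@Ipi R) x.
  by move=> [/= xI _]; rewrite /Ipi/= in_itv.
have OI x t : Omega T (x, t) -> (@Ipi R) x.
  by move=> [/= /andP[/ltW x1 /ltW x2] _]; rewrite /Ipi/= in_itv/= x1.
have OOb : Omega T `<=` Omega_bar T.
  by move=> [x t] [/= /andP[? ?] /andP[? ?]]; split => /=; rewrite !ltW.
exists (fun x t => phi1 x + v1x x t + v2x x t),
  (fun x t => phi2 x + v1xx x t + v2xx x t), (fun x t => m + v1t x t + v2t x t).
do !split.
- do 3 (apply: within_continuousD => //); exact: lift_continuous cphi ObI.
- move=> x t xt; have xI := ObI _ _ xt.
  have [e1 _] := d1 x t xt; have [e2 _] := d2 x t xt.
  have e0 : deriv_within (@Ipi R) (fun y => phi y + t * m) x (phi1 x + 0).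
    by apply: deriv_withinD; [exact: dp1|apply: is_derive_within; exact: is_derive_cst].
  by have := deriv_withinD (deriv_withinD e0 e1) e2; rewrite addr0.
- do 2 (apply: within_continuousD => //); exact: lift_continuous cphi1 ObI.
- move=> x t xt; have xI := OI _ _ xt.
  have [_ e1] := d1 x t (OOb _ xt); have [_ e2] := d2 x t (OOb _ xt).
  apply: deriv_within_subset (deriv_withinD (deriv_withinD (dp2 x xI) e1) e2).
  by move=> y /= /andP[/ltW y1 /ltW y2]; rewrite /Ipi/= in_itv/= y1.
- move=> x t xt.
  have e0 : deriv_within [set s | 0 < s < T] (fun s => phi x + s * m) t (0 + m * 1).
    apply: deriv_withinD; first by apply: is_derive_within; exact: is_derive_cst.
    apply: is_derive_within; rewrite (_ : (fun s => s * m) = (fun s => m * s)).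
      by apply: is_derive_mulc; exact: is_derive_id.
    by apply/funext => s; rewrite mulrC.
  rewrite add0r mulr1 in e0.
  exact: deriv_withinD (deriv_withinD e0 (d1t x t xt)) (d2t x t xt).
- do 2 (apply: within_continuousD; last exact: continuous_subspaceW OOb _).
  exact: lift_continuous cphi2 OI.
- do 2 (apply: within_continuousD; last exact: continuous_subspaceW OOb _).
  exact: within_continuous_cst.
- do 2 (apply: within_continuousD => //).
  apply: within_continuousD; last exact: within_continuous_cst.
  apply: within_continuousD.
    rewrite (_ : (fun x => - phi2 x) = (fun x => 0 - phi2 x)).
      by apply: within_continuousB => //; exact: within_continuous_cst.
    by apply/funext => x; rewrite sub0r.
  apply: within_continuousM; first exact: within_continuous_cst.
  exact: within_continuous_opp.
(* The terms -phi'' and eps phi''(-x) of [F] absorb the unexpanded phi, and [m] is the time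
   derivative of t m; the rest is the sum of the two mode equations. *)
- move=> x t xt; rewrite /F /f1 /f2 -(h1 x t xt) -(h2 x t xt); lra.
- by move=> x xI; rewrite /U /w1 /w2 !mode_series_init mul0r !addr0.
- exact: final_condition.
- by have [-> _] := b1 t; have [-> _] := b2 t; rewrite phil !addr0.
- by have [_ ->] := b1 t; have [_ ->] := b2 t; rewrite phir !addr0.
Qed.

Let lam2 (k : nat) := (1 - eps) * k%:R ^+ 2.
Let lam1 (k : nat) := (1 + eps) * (k%:R + 2^-1) ^+ 2.

Let lamcE k : lamc k = lam2 k.+1. Proof. by rewrite /lamc mulr1. Qed.
Let lamsE k : lams k = lam1 k. Proof. by rewrite /lams mulrN1 opprK. Qed.

Lemma series_solution_formula x t : Omega_bar T (x, t) -> exists s1 s2,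
  [/\ series_to 1 (fun k => (1 - expR (- lam2 k * t)) *
         (fcoef2 psi3 k - fcoef2 phi3 k)
         / ((1 - expR (- lam2 k * T)) * k%:R ^+ 3) * cos (k%:R * x)) s1,
      series_to 0 (fun k => (1 - expR (- lam1 k * t)) *
         (fcoef1 psi3 k - fcoef1 phi3 k)
         / ((1 - expR (- lam1 k * T)) * (k%:R + 2^-1) ^+ 3)
         * sin ((k%:R + 2^-1) * x)) s2 &
      U x t = phi x + t / T * (mean0 psi - mean0 phi) + s1 - s2].
Proof.
move=> [/= _ /andP[t0 _]].
have c1 := mode_series_cvg T0 a_cos ec1 nuc_half bc_summable (x := x) t0.
have c2 := mode_series_cvg T0 a_sin es1 nus_half bs_summable (x := x) t0.
(* The stated formula subtracts the sine series, which undoes the sign in [bs]. *)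
exists (1 * w1 x t), (- 1 * w2 x t); split.
- refine (series_to1 _ c1) => k.
  by rewrite -lamcE mul1r; exact: solution_term.
- refine (series_to0 _ c2) => k.
  by rewrite -lamsE -solution_term /bs !mulNr mul1r opprK.
- by rewrite /U /m; lra.
Qed.

Lemma series_source_formula x : exists s1 s2,
  [/\ series_to 1 (fun k => (1 - eps) * (fcoef2 phi3 k - fcoef2 psi3 k)
         / (k%:R * (1 - expR (- lam2 k * T))) * cos (k%:R * x)) s1,
      series_to 0 (fun k => (1 + eps) * (fcoef1 phi3 k - fcoef1 psi3 k)
         / ((k%:R + 2^-1) * (1 - expR (- lam1 k * T)))
         * sin ((k%:R + 2^-1) * x)) s2 &
      F x = - phi2 x + eps * phi2 (- x) + (mean0 psi - mean0 phi) / T - s1 + s2].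
Proof.
have c1 := source_series_cvg T0 a_cos ec1 nuc_half bc_summable (x := x).
have c2 := source_series_cvg T0 a_sin es1 nus_half bs_summable (x := x).
(* The source formula uses phi - psi: this reverses the sign of [bc] and agrees with that of
   [bs]. *)
exists (- 1 * f1 x), (1 * f2 x); split.
- refine (series_to1 _ c1) => k.
  have n0 : k.+1%:R != 0 :> R by rewrite pnatr_eq0.
  rewrite -lamcE -(@source_term _ (1 - eps) (lamc k) (fcoef2 phi3 k.+1)
    (fcoef2 psi3 k.+1) _ _ _ n0 (lamcE k)).
  by rewrite !mulNr mul1r.
- refine (series_to0 _ c2) => k.
  have n0 : k%:R + 2^-1 != 0 :> R by rewrite gt_eqF// ltr_wpDl// invr_gt0.
  by rewrite -lamsE mul1r -(@source_term _ (1 + eps) (lams k) (fcoef1 phi3 k)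
    (fcoef1 psi3 k) _ _ _ n0 (lamsE k)).
- by rewrite /F /m; lra.
Qed.

End Assembly.

Theorem theorem2 (R : realType) (T eps : R)
    (phi phi1 phi2 phi3 psi psi1 psi2 psi3 : R -> R) :
  0 < T -> eps != 0 -> `|eps| < 1 ->
  C2_H3_data phi phi1 phi2 phi3 -> C2_H3_data psi psi1 psi2 psi3 ->
  phi1 (- pi) = 0 -> phi1 pi = 0 -> psi1 (- pi) = 0 -> psi1 pi = 0 ->
  let phi0 := mean0 phi in
  let psi0 := mean0 psi in
  let p1 := fcoef1 phi3 in let p2 := fcoef2 phi3 in
  let q1 := fcoef1 psi3 in let q2 := fcoef2 psi3 in
  let lam2 := fun k : nat => (1 - eps) * (k%:R) ^+ 2 in
  let lam1 := fun k : nat => (1 + eps) * (k%:R + 2^-1) ^+ 2 in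
  (exists u f, regular_solution eps T phi psi u f) /\
  (forall u f, regular_solution eps T phi psi u f ->
     (forall x t, Omega_bar T (x, t) ->
        exists s1 s2,
          series_to 1 (fun k => (1 - expR (- lam2 k * t)) * (q2 k - p2 k)
                         / ((1 - expR (- lam2 k * T)) * (k%:R) ^+ 3)
                         * cos (k%:R * x)) s1 /\
          series_to 0 (fun k => (1 - expR (- lam1 k * t)) * (q1 k - p1 k)
                         / ((1 - expR (- lam1 k * T)) * (k%:R + 2^-1) ^+ 3)
                         * sin ((k%:R + 2^-1) * x)) s2 /\
          u x t = phi x + t / T * (psi0 - phi0) + s1 - s2) /\
     (forall x, Ipi x ->
        exists s1 s2,
          series_to 1 (fun k => (1 - eps) * (p2 k - q2 k)
                         / (k%:R * (1 - expR (- lam2 k * T)))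
                         * cos (k%:R * x)) s1 /\
          series_to 0 (fun k => (1 + eps) * (p1 k - q1 k)
                         / ((k%:R + 2^-1) * (1 - expR (- lam1 k * T)))
                         * sin ((k%:R + 2^-1) * x)) s2 /\
          f x = - phi2 x + eps * phi2 (- x) + (psi0 - phi0) / T - s1 + s2)).
Proof.
move=> T0 _ eps1 dphi dpsi phil phir psil psir phi0 psi0 p1 p2 q1 q2 lam2 lam1.
have sol := series_regular_solution T0 eps1 dphi dpsi phil phir psil psir.
split; first by do 2 eexists; exact: sol.
(* The formulas are known for the constructed pair; uniqueness carries them to any regular
   solution. *)
move=> u f usol; have [uE fE] := regular_solution_unique T0 usol sol.
split=> [x t xt|x xI].
  have [s1 [s2 [h1 h2 h3]]] :=
    series_solution_formula T0 eps1 dphi dpsi xt.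
  by exists s1, s2; rewrite (uE x t xt) h3.
have [s1 [s2 [h1 h2 h3]]] := series_source_formula T0 eps1 dphi dpsi x.
by exists s1, s2; rewrite (fE x xI) h3.
Qed.
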